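(* There is a universal constant $c>0$ such that the following holds. Let $G=(V,E)$ be a graph of maximum degree $\Delta$ with $n=|V|$, let $q\ge 2$ be an integer, let $C\ge 0$ and $\eta\in[0,1)$, and let $\mu$ be a $(C,\eta)$-spectrally independent distribution on $[q]^V$. Suppose that $50\lceil 2C\rceil\Delta\le n$. Then the Glauber dynamics for $\mu$ has spectral gap at least \[ c\,\frac{(1-\eta)^{1+2C}}{(25\Delta\lceil 2C\rceil)^{5\lceil 2C\rceil}}\cdot\frac{1}{|V|}. \]
   Context: $[q]=\{1,\dots,q\}$. For a distribution $\mu$ on $[q]^V$, let $\Omega=\{\sigma:\mu(\sigma)>0\}$; for $\Lambda\subseteq V$ let $\mu_\Lambda$ be the marginal of $\mu$ on $[q]^\Lambda$ and $\Omega_\Lambda=\{\tau\in[q]^\Lambda:\mu_\Lambda(\tau)>0\}$. For $\tau\in\Omega_\Lambda$ and $u\notin\Lambda$, let $\Omega_u^\tau$ be the set of spins $i$ with $\mu(\sigma_u=i\mid\sigma_\Lambda=\tau)>0$. Influence matrix: for $\Lambda\subsetneq V$ and $\tau\in\Omega_\Lambda$, let $\tilde V_\tau=\{(u,i):u\in V\setminus\Lambda,\ i\in\Omega_u^\tau\}$ and define the $\tilde V_\tau\times\tilde V_\tau$ matrix $\Psi^\tau_\mu$ by $\Psi^\tau_\mu((u,i),(v,j))=\mu(\sigma_v=j\mid\sigma_u=i,\sigma_\Lambda=\tau)-\mu(\sigma_v=j\mid\sigma_\Lambda=\tau)$ for $u\ne v$, and $\Psi^\tau_\mu((v,i),(v,j))=0$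 for all $i,j$ (its eigenvalues are real). $(C,\eta)$-spectral independence: for every $\Lambda\subseteq V$ with $k:=|\Lambda|\le n-2$ and every $\tau\in\Omega_\Lambda$, the largest eigenvalue of $\Psi^\tau_\mu$ is at most $\min\{C,\eta(n-k-1)\}$. Glauber dynamics for $\mu$: the Markov chain on $\Omega$ which, from $X_{t-1}$, picks $v\in V$ uniformly at random and resamples the spin at $v$ from $\mu(\sigma_v=\cdot\mid\sigma_w=X_{t-1}(w)\ \forall w\ne v)$, keeping all other spins. It is reversible w.r.t. $\mu$; if its eigenvalues are $1=\lambda_1\ge\lambda_2\ge\dots\ge\lambda_N$, its (absolute) spectral gap is $1-\max\{|\lambda_2|,|\lambda_N|\}$.
   Formalization: The distribution μ is additionally assumed to be a Markov random field on G (spins on vertex sets with no edge between them are independent given all other spins), without which the claim is false; for Δ=0<C the undefined bound is read as 0. *)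

(* Defs.v *)
From HB Require Import structures.
From mathcomp Require Import all_boot all_order all_algebra.
From mathcomp Require Import reals exp.
Set Implicit Arguments.
Unset Strict Implicit.
Unset Printing Implicit Defensive.
Import Order.TTheory GRing.Theory Num.Theory.
Local Open Scope ring_scope.

Section FiniteMatrices.
Variable R : realType.

Definition mx_of (T : finType) (f : T -> T -> R) : 'M[R]_#|T| :=
  \matrix_(i, j) f (enum_val i) (enum_val j).

(* s lists the eigenvalues of A, with algebraic multiplicity, in nonincreasing
   order; in particular all the eigenvalues of A are real. *)
Definition is_spectrum (n : nat) (A : 'M[R]_n) (s : seq R) : Prop :=
  sorted >=%R s /\ char_poly A = \prod_(x <- s) ('X - x%:P).

(* With indices starting at 0, lambda_2 is nth 0 s 1 and lambda_N is
   nth 0 s (size s).-1.  A chain with a single state has no lambda_2; its gap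
   is 1 by convention. *)
Definition abs_gap (s : seq R) : R :=
  if (size s < 2)%N then 1
  else 1 - Num.max `|nth 0 s 1| `|nth 0 s (size s).-1|.

Definition is_spectral_gap (n : nat) (A : 'M[R]_n) (g : R) : Prop :=
  exists2 s : seq R, is_spectrum A s & g = abs_gap s.

End FiniteMatrices.

Section Distributions.
Variables (R : realType) (V : finType) (q : nat).

Definition config : Type := {ffun V -> 'I_q}.

Definition pconfig (L : {set V}) : Type := {ffun {v : V | v \in L} -> 'I_q}.

Variable mu : config -> R.

Definition is_distribution : Prop :=
  (forall s, 0 <= mu s) /\ \sum_s mu s = 1.

Definition Pr (A : {set {ffun V -> 'I_q}}) : R := \sum_(s in A) mu s.

Definition condPr (A B : {set {ffun V -> 'I_q}}) : R := Pr (A :&: B) / Pr B.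

Definition spin_is (v : V) (i : 'I_q) : {set {ffun V -> 'I_q}} :=
  [set s : {ffun V -> 'I_q} | s v == i].

Definition extends (L : {set V}) (tau : pconfig L) : {set {ffun V -> 'I_q}} :=
  [set s : {ffun V -> 'I_q} | [forall w : {v : V | v \in L}, s (val w) == tau w]].

(* Membership of tau in Omega_L *)
Definition feasible (L : {set V}) (tau : pconfig L) : bool :=
  0 < Pr (extends tau).

Definition infl_index (L : {set V}) (tau : pconfig L) : finType :=
  {x : V * 'I_q |
    (x.1 \notin L) && (0 < condPr (spin_is x.1 x.2) (extends tau))}.

Definition influence (L : {set V}) (tau : pconfig L)
    (x y : infl_index tau) : R :=
  let: (u, i) := val x in
  let: (v, j) := val y in
  if u == v then 0
  else condPr (spin_is v j) (spin_is u i :&: extends tau)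
       - condPr (spin_is v j) (extends tau).

Definition influence_mx (L : {set V}) (tau : pconfig L) :=
  mx_of (@influence L tau).

(* The eigenvalues of influence matrices are all real, so bounding every
   eigenvalue in R bounds the largest one. *)
Definition spectrally_independent (C eta : R) : Prop :=
  forall (L : {set V}) (tau : pconfig L),
    (#|L| + 2 <= #|V|)%N -> feasible tau ->
    forall a : R, eigenvalue (influence_mx tau) a ->
      a <= Num.min C (eta * (#|V| - #|L| - 1)%:R).

Definition glauber_state : finType := {s : {ffun V -> 'I_q} | 0 < mu s}.

Definition same_off (v : V) (s : {ffun V -> 'I_q}) : {set {ffun V -> 'I_q}} :=
  [set t : {ffun V -> 'I_q} | [forall w, (w != v) ==> (t w == s w)]].

Definition glauber (x y : glauber_state) : R :=
  \sum_(v : V) #|V|%:R^-1 *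
    (if val y \in same_off v (val x)
     then condPr (spin_is v (val y v)) (same_off v (val x)) else 0).

Definition glauber_mx := mx_of glauber.

(* Global Markov property, for separations that exhaust V: if no edge joins A
   and B then, given the spins outside A :|: B, those in A and in B are
   independent.  Every Gibbs distribution of a spin system on the graph,
   with soft or hard constraints, has this property. *)
Definition markov_random_field (e : rel V) : Prop :=
  forall (A B : {set V}), [disjoint A & B] ->
    (forall u v, u \in A -> v \in B -> ~~ e u v) ->
    forall (tau : pconfig (~: (A :|: B))) (al : pconfig A) (be : pconfig B),
      feasible tau ->
      condPr (extends al :&: extends be) (extends tau) =
      condPr (extends al) (extends tau) * condPr (extends be) (extends tau).

End Distributions.

Definition simple_graph (V : finType) (e : rel V) : Prop :=
  symmetric e /\ irreflexive e.

Definition max_degree (V : finType) (e : rel V) : nat :=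
  \max_(u : V) #|[set v | e u v]|.

(* Main.v *)
Require Import Defs.
From HB Require Import structures.
From mathcomp Require Import all_boot all_order all_algebra.
From mathcomp Require Import reals exp.
From mathcomp Require Import complex ring lra.
Set Implicit Arguments.
Unset Strict Implicit.
Unset Printing Implicit Defensive.
Import Order.TTheory GRing.Theory Num.Theory.
Local Open Scope ring_scope.

(* Write E_S f for the conditional expectation of f given the spins outside S,
   and A(S) for the mean of the corresponding conditional variance, so that
   A(V) is the variance of f and the Dirichlet form is the sum of the A({v})
   divided by n = |V|.  Let k be the ceiling of 2C.
   - Spectral independence at a pinning with free set S says that
     Var(sum_u g_u) <= (1 + lambda) sum_u Var(g_u) for functions g_u of the
     spin at u.  By duality,
     (|S| - 1 - lambda) A(S) <= sum_(u in S) A(S minus u),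
     where lambda = min(C, eta (|S| - 1)).
   - Iterated down to singletons this bounds A(U) by
     (1 - eta)^-k 2^|U| sum_(v in U) A({v}), which is good for small U only.
   - Iterated down to sets of size l, of order n / Delta, it costs only a
     factor (n/l)^(k+1).
   - A random set of size l shatters: by the Markov property A(S) is at most
     the sum of the A(U) over connected U inside S; such a U is included with
     probability at most (l/n)^|U|, which beats both the number of connected
     sets through a vertex, exponential in |U| with base of order Delta, and
     the factor 2^|U|. *)

(** * Real symmetric matrices *)

(** [P] intertwines the two characteristic matrices, and its determinant cancels as a nonzero
    constant polynomial. *)
Lemma char_poly_similar (F : fieldType) n (P A B : 'M[F]_n) :
  P \in unitmx -> P *m A = B *m P -> char_poly A = char_poly B.
Proof.
move=> uP eqPAB; have nzP : (\det P)%:P != 0 :> {poly F}.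
  by rewrite polyC_eq0 -unitfE -unitmxE.
apply: (mulfI nzP); rewrite /char_poly [RHS]mulrC -!det_map_mx -!det_mulmx; congr (\det _).
rewrite /char_poly_mx mulmxBr mulmxBl mul_mx_scalar mul_scalar_mx.
by rewrite -!map_mxM eqPAB.
Qed.

Section SymmetricMatrices.
Variable R : rcfType.
Local Open Scope sesquilinear_scope.
Local Notation "A %:CM" := (map_mx (real_complex R) A) (at level 2, format "A %:CM").

Lemma conjC_map_real m n (A : 'M[R]_(m, n)) : map_mx Num.conj A%:CM = A%:CM.
Proof. by apply/matrixP => i j; rewrite !mxE; exact: conjc_real. Qed.

(** A real symmetric matrix is Hermitian over [R[i]], so its spectral diagonal is real. The
    eigenbasis [U] may stay complex: only eigenvalues and quadratic forms are used below. *)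
Lemma sym_spectral n (S : 'M[R]_n) : S^T = S ->
  exists (U : 'M[R[i]]_n) (d : 'rV[R]_n), U \is unitarymx /\
    S%:CM = U^t* *m diag_mx d%:CM *m U.
Proof.
move=> symS.
have herm : S%:CM \is hermsymmx.
  apply: realsym_hermsym.
    apply/is_hermitianmxP.
    by rewrite /= expr0 scale1r map_mx_id // map_trmx symS.
  by apply/mxOverP => i j; rewrite mxE complex_real.
pose U := spectralmx S%:CM.
have dr := hermitian_spectral_diag_real herm.
have /hermitian_normalmx/orthomx_spectralP eqS := herm.
exists U, (map_mx (@complex.Re R) (spectral_diag S%:CM)); split.
  exact: spectral_unitarymx.
rewrite [LHS]eqS invmx_unitary ?spectral_unitarymx //; congr (_ *m diag_mx _ *m _).
by apply/rowP => i; rewrite !mxE RRe_real //; move/mxOverP: dr; apply.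
Qed.

Lemma char_poly_spectral n (S : 'M[R]_n) (U : 'M[R[i]]_n) (d : 'rV[R]_n) :
  U \is unitarymx -> S%:CM = U^t* *m diag_mx d%:CM *m U ->
  char_poly S = \prod_i ('X - (d 0 i)%:P).
Proof.
move=> unU eqS; apply: (map_poly_inj (real_complex R)).
rewrite map_char_poly eqS -invmx_unitary //.
have uU := unitarymx_unit unU.
rewrite (@char_poly_similar _ _ U _ (diag_mx d%:CM)) //; last first.
  by rewrite !mulmxA mulmxV // mul1mx.
rewrite rmorph_prod /= char_poly_trig ?diag_mx_is_trig //.
apply: eq_bigr => i _.
by rewrite rmorphB /= map_polyX map_polyC /= !mxE eqxx mulr1n.
Qed.

Lemma unitary_quad n (S : 'M[R]_n) (U : 'M[R[i]]_n) (d : 'rV[R]_n) (y : 'rV[R[i]]_n) :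
  U \is unitarymx -> S%:CM = U^t* *m diag_mx d%:CM *m U ->
  ((y *m U) *m S%:CM *m (y *m U)^t*) 0 0 = \sum_i (d 0 i)%:C%C * `|y 0 i| ^+ 2.
Proof.
move=> unU ->; have UU := unitarymxP unU.
rewrite trmx_mul map_mxM /= !mulmxA -[_ *m U *m U^t*]mulmxA UU mulmx1.
rewrite -[y *m U *m _]mulmxA UU mulmx1 -mulmxA mul_diag_mx mxE.
apply: eq_bigr => i _; rewrite !mxE; rewrite sqr_normc /=.
by rewrite mulrCA.
Qed.

Lemma unitary_norm n (U : 'M[R[i]]_n) (y : 'rV[R[i]]_n) : U \is unitarymx ->
  ((y *m U) *m (y *m U)^t*) 0 0 = \sum_i `|y 0 i| ^+ 2.
Proof.
move=> unU; rewrite trmx_mul map_mxM /= !mulmxA.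
rewrite -[y *m U *m _]mulmxA (unitarymxP unU) mulmx1 mxE.
by apply: eq_bigr => i _; rewrite !mxE sqr_normc.
Qed.

Lemma spectral_root n (S : 'M[R]_n) (U : 'M[R[i]]_n) (d : 'rV[R]_n) i :
  U \is unitarymx -> S%:CM = U^t* *m diag_mx d%:CM *m U -> eigenvalue S (d 0 i).
Proof.
move=> unU eqS; rewrite eigenvalue_root_char (char_poly_spectral unU eqS).
by rewrite (bigD1 i) //= rootM root_XsubC eqxx.
Qed.

(** The Rayleigh bound, read in the eigenbasis. It covers complex rows because [second_eigenvalue]
    tests it on a complex combination of eigenvectors. *)
Lemma quad_le_complex n (S : 'M[R]_n) (a : R) (h : 'rV[R[i]]_n) : S^T = S ->
  (forall b, eigenvalue S b -> b <= a) ->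
  (h *m S%:CM *m h^t*) 0 0 <= a%:C%C * (h *m h^t*) 0 0.
Proof.
move=> /sym_spectral[U [d [unU eqS]]] le_a.
have -> : h = (h *m U^t*) *m U.
  by rewrite -mulmxA -invmx_unitary // mulVmx ?mulmx1 ?unitarymx_unit.
rewrite (unitary_quad _ unU eqS) (unitary_norm _ unU) mulr_sumr ler_sum // => i _.
rewrite ler_wpM2r ?exprn_ge0 // lecR; apply: le_a.
exact: spectral_root unU eqS.
Qed.

Lemma quad_le_eigen n (S : 'M[R]_n) (a : R) (g : 'rV[R]_n) : S^T = S ->
  (forall b, eigenvalue S b -> b <= a) ->
  (g *m S *m g^T) 0 0 <= a * (g *m g^T) 0 0.
Proof.
move=> symS le_a; have := quad_le_complex g%:CM symS le_a.
rewrite -map_trmx conjC_map_real map_trmx -!map_mxM.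
by move: (g *m S *m g^T) (g *m g^T) => p r; rewrite !mxE -rmorphM /= lecR.
Qed.

Lemma eigenvalue_quad n (S : 'M[R]_n) a b : eigenvalue S a ->
  (forall g : 'rV[R]_n, (g *m S *m g^T) 0 0 <= b * (g *m g^T) 0 0) -> a <= b.
Proof.
move=> /eigenvalueP[g eqg nzg] /(_ g); rewrite eqg -scalemxAl mxE ler_pM2r //.
rewrite mxE; have : exists i, g 0 i != 0.
  apply/existsP; apply: contraNT nzg; rewrite negb_exists => /forallP g0.
  by apply/eqP/rowP => i; rewrite mxE; apply/eqP; have := g0 i; rewrite negbK.
case=> i nzi; rewrite (bigD1 i) //= ltr_wpDr //.
  by apply: sumr_ge0 => j _; rewrite mxE -expr2 sqr_ge0.
by rewrite mxE -expr2 exprn_even_gt0.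
Qed.

(* If two eigenvalues exceeded [1 - g], a complex combination of two orthonormal
   eigenvectors for them would be orthogonal to [w] and contradict [gapS]. *)
Lemma second_eigenvalue n (S : 'M[R]_n) (U : 'M[R[i]]_n) (d w : 'rV[R]_n) g i j :
  S^T = S -> U \is unitarymx -> S%:CM = U^t* *m diag_mx d%:CM *m U ->
  (forall x : 'rV[R]_n, (x *m S *m x^T) 0 0 <=
    (1 - g) * (x *m x^T) 0 0 + g * ((x *m w^T) 0 0) ^+ 2) ->
  i != j -> 1 - g < d 0 i -> 1 - g < d 0 j -> False.
Proof.
move=> symS unU eqS gapS neq_ij lti ltj.
(* Subtracting the rank-one form of [w] turns [gapS] into the bound [1 - g] on every eigenvalue of
   [B]. *)
pose B := S - g *: (w^T *m w).
have symB : B^T = B by rewrite /B linearB linearZ /= trmx_mul trmxK symS.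
have le_B b : eigenvalue B b -> b <= 1 - g.
  move=> /eigenvalue_quad; apply=> x.
  rewrite /B mulmxBr mulmxBl -scalemxAr -scalemxAl mulmxA -[_ *m w *m _]mulmxA.
  have -> : w *m x^T = (x *m w^T)^T by rewrite trmx_mul trmxK.
  have := gapS x; move: (x *m S *m x^T) (x *m x^T) (x *m w^T) => p r t.
  by rewrite !mxE big_ord1 !mxE; lra.
pose z m : R[i] := (U *m (w^T)%:CM) m 0.
(* Coordinates, in the eigenbasis, of a vector orthogonal to [w]. The case [z i = 0] is separate
   because the general formula gives 0 when [z i] and [z j] both vanish. *)
pose y : 'rV[R[i]]_n :=
  if z i == 0 then delta_mx 0 i else z j *: delta_mx 0 i - z i *: delta_mx 0 j.
have y_off m : m != i -> m != j -> y 0 m = 0.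
  move=> mi mj; rewrite /y; case: ifP => _; rewrite !mxE /= (negPf mi) //.
  by rewrite (negPf mj) !mulr0 subr0.
have zy : y *m (U *m (w^T)%:CM) = 0.
  apply/matrixP => a b; rewrite !ord1 !mxE.
  rewrite (bigD1 i) //= (bigD1 j) 1?eq_sym //= big1 ?addr0.
    rewrite -![(U *m _) _ _]/(z _) /y; case: eqP => [z0|_]; rewrite !mxE !eqxx /=.
      by rewrite z0 mulr0 [j == i]eq_sym (negPf neq_ij) mul0r addr0.
    by rewrite [j == i]eq_sym (negPf neq_ij) !mulr0 !mulr1 subr0 sub0r mulNr mulrC subrr.
  by move=> m /andP[mi mj]; rewrite y_off // mul0r.
have nzy : y 0 i != 0 \/ y 0 j != 0.
  rewrite /y; case: (z i =P 0) => [_|/eqP nz]; rewrite !mxE !eqxx /=.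
    by left; rewrite oner_neq0.
  by right; rewrite [j == i]eq_sym (negPf neq_ij); rewrite mulr0 mulr1 sub0r oppr_eq0.
have := quad_le_complex (y *m U) symB le_B.
have -> : ((y *m U) *m B%:CM *m (y *m U)^t*) 0 0 =
          ((y *m U) *m S%:CM *m (y *m U)^t*) 0 0.
  rewrite /B map_mxB map_mxZ map_mxM mulmxBr mulmxBl -scalemxAr mulmxA.
  have -> : y *m U *m (w^T)%:CM = 0 by rewrite -mulmxA.
  by rewrite mul0mx scaler0 mul0mx subr0.
rewrite (unitary_quad _ unU eqS) (unitary_norm _ unU) mulr_sumr -subr_ge0 -sumrB.
apply/negP; apply/negbT/lt_geF.
rewrite (bigD1 i) //= (bigD1 j) 1?eq_sym //= big1 ?addr0; last first.
  by move=> m /andP[mi mj]; rewrite y_off // normr0 expr0n /= !mulr0 subrr.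
rewrite -!mulrBl -!rmorphB /=.
have ai : ((1 - g) - d 0 i)%:C%C < 0 by rewrite ltcR subr_lt0.
have aj : ((1 - g) - d 0 j)%:C%C < 0 by rewrite ltcR subr_lt0.
have [yi|yj] := nzy.
  rewrite ltr_wnDr //; first by rewrite mulr_le0_ge0 ?exprn_ge0 // ltW.
  by rewrite nmulr_rlt0 // exprn_gt0 // normr_gt0.
rewrite ltr_wnDl //; first by rewrite mulr_le0_ge0 ?exprn_ge0 // ltW.
by rewrite nmulr_rlt0 // exprn_gt0 // normr_gt0.
Qed.

End SymmetricMatrices.

(** * Reversible kernels *)

Section ReversibleKernels.
Variables (R : realType) (T : finType) (w : T -> R) (P : T -> T -> R).
Hypotheses (w_gt0 : forall x, 0 < w x)
  (revP : forall x y, w x * P x y = w y * P y x).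

Let r x := Num.sqrt (w x).
Let r_gt0 x : 0 < r x. Proof. by rewrite sqrtr_gt0. Qed.
Let r2 x : r x ^+ 2 = w x. Proof. by rewrite sqr_sqrtr // ltW. Qed.

(** The conjugate of [P] by the diagonal matrix of [r]: same spectrum, and symmetric by detailed
    balance. *)
Definition symmetrized := mx_of (fun x y => r x * P x y / r y).

Lemma symmetrized_sym : symmetrized^T = symmetrized.
Proof.
apply/matrixP => i j; rewrite !mxE; move: (enum_val i) (enum_val j) => x y.
have rx := lt0r_neq0 (r_gt0 x); have ry := lt0r_neq0 (r_gt0 y).
apply: (mulfI rx); apply: (mulfI ry).
transitivity (r y ^+ 2 * P y x); first by field.
by rewrite r2 -revP -r2; field.
Qed.

Lemma char_poly_symmetrized : char_poly (mx_of P) = char_poly symmetrized.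
Proof.
apply: (@char_poly_similar _ _ (diag_mx (\row_i r (enum_val i)))).
  rewrite unitmxE det_diag unitfE; apply/prodf_neq0 => i _.
  by rewrite mxE lt0r_neq0.
rewrite mul_diag_mx mul_mx_diag; apply/matrixP => i j; rewrite !mxE.
by rewrite mulfVK // lt0r_neq0.
Qed.

(** An isometry from functions with the [w]-weighted inner product to Euclidean rows. *)
Definition weighted_row (f : T -> R) : 'rV[R]_#|T| := \row_i (r (enum_val i) * f (enum_val i)).

Lemma weighted_row_onto (g : 'rV[R]_#|T|) : exists f, g = weighted_row f.
Proof.
exists (fun x => g 0 (enum_rank x) / r x); apply/rowP => i.
by rewrite mxE enum_valK mulrC mulfVK // lt0r_neq0.
Qed.

Lemma weighted_row_quad f :
  (weighted_row f *m symmetrized *m (weighted_row f)^T) 0 0 =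
  \sum_x \sum_y w x * P x y * f x * f y.
Proof.
rewrite exchange_big /= (reindex (@enum_val T T)) /=; last first.
  by apply: onW_bij; exact: enum_val_bij.
rewrite mxE; apply: eq_bigr => j _.
rewrite !mxE mulr_suml (reindex (@enum_val T T)) /=; last first.
  by apply: onW_bij; exact: enum_val_bij.
apply: eq_bigr => i _; rewrite !mxE -r2.
by have ry := lt0r_neq0 (r_gt0 (enum_val j)); field.
Qed.

Lemma weighted_row_dot f : (weighted_row f *m (weighted_row f)^T) 0 0 = \sum_x w x * f x ^+ 2.
Proof.
rewrite mxE (reindex (@enum_val T T)) /=; last by apply: onW_bij; exact: enum_val_bij.
by apply: eq_bigr => i _; rewrite !mxE -r2; ring.
Qed.

Lemma weighted_row_mean f : (weighted_row f *m (weighted_row (fun=> 1))^T) 0 0 = \sum_x w x * f x.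
Proof.
rewrite mxE (reindex (@enum_val T T)) /=; last by apply: onW_bij; exact: enum_val_bij.
by apply: eq_bigr => i _; rewrite !mxE -r2; ring.
Qed.

Lemma reversible_quad_le a (f : T -> R) :
  (forall b, eigenvalue (mx_of P) b -> b <= a) ->
  \sum_x \sum_y w x * P x y * f x * f y <= a * \sum_x w x * f x ^+ 2.
Proof.
move=> le_a; rewrite -weighted_row_quad -weighted_row_dot; apply: quad_le_eigen => [|b].
  exact: symmetrized_sym.
by rewrite eigenvalue_root_char -char_poly_symmetrized -eigenvalue_root_char; exact: le_a.
Qed.

(** Nonnegativity of the form excludes negative eigenvalues, so the second largest eigenvalue alone
    decides the absolute gap. The last hypothesis is that of [second_eigenvalue] for the row of the
    constant function 1. *)
Lemma reversible_gap g : 0 <= g <= 1 ->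
  (forall f : T -> R, 0 <= \sum_x \sum_y w x * P x y * f x * f y) ->
  (forall f : T -> R, \sum_x \sum_y w x * P x y * f x * f y <=
     (1 - g) * (\sum_x w x * f x ^+ 2) + g * (\sum_x w x * f x) ^+ 2) ->
  exists2 gap, is_spectral_gap (mx_of P) gap & g <= gap.
Proof.
move=> /andP[g_ge0 g_le1] psd poin.
have [U [d [unU eqS]]] := sym_spectral symmetrized_sym.
have cp := char_poly_spectral unU eqS.
pose s := sort >=%R [seq d 0 i | i <- enum 'I_#|T|].
have perm_s : perm_eq s [seq d 0 i | i <- enum 'I_#|T|] by rewrite perm_sort.
have sort_s : sorted >=%R s by apply: sort_sorted => x y; exact: le_total.
exists (abs_gap s).
  exists s => //; split=> //; rewrite char_poly_symmetrized cp.
  by rewrite (perm_big _ perm_s) /= big_map big_enum.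
rewrite /abs_gap; case: ltnP => [//|sz2].
have d_ge0 i : 0 <= d 0 i.
  rewrite -oppr_le0; have : eigenvalue (- symmetrized) (- d 0 i).
    have /eigenvalueP[v ev nz] := spectral_root i unU eqS.
    by apply/eigenvalueP; exists v => //; rewrite mulmxN ev scaleNr.
  move/eigenvalue_quad; apply=> v; have [f ->] := weighted_row_onto v.
  by rewrite mulmxN mulNmx mxE weighted_row_quad mul0r oppr_le0.
have s_ge0 x : x \in s -> 0 <= x.
  by rewrite (perm_mem perm_s) => /mapP[i _ ->].
have le2 : nth 0 s 1 <= 1 - g.
  rewrite leNgt; apply/negP => lt1.
  have lt0 : 1 - g < nth 0 s 0.
    apply: (lt_le_trans lt1); case: (s) sort_s sz2 => [|a [|b t]] //=.
    by case/andP.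
  (* Counting entries with multiplicity yields two distinct indices [i] and [j] even when the
     eigenvalue is repeated. *)
  have : (1 < count (fun x => (1 - g < x)%R) s)%N.
    by case: (s) lt0 lt1 sz2 => [|a [|b t]] //= -> -> _; rewrite !add1n.
  rewrite (permP perm_s) count_map -size_filter.
  set l := filter _ _.
  have ul : uniq l by rewrite filter_uniq // enum_uniq.
  have : all (fun i => 1 - g < d 0 i) l by rewrite filter_all.
  case: l ul => [|i [|j t]] //= /andP[]; rewrite inE negb_or => /andP[neq_ij _] _.
  case/and3P=> lti ltj _ _.
  apply: (@second_eigenvalue _ _ _ U d (weighted_row (fun=> 1)) g i j symmetrized_sym
    unU eqS) => //.
  move=> v; have [f ->] := weighted_row_onto v.
  by rewrite weighted_row_quad weighted_row_dot weighted_row_mean.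
have nth_ge0 m : (m < size s)%N -> 0 <= nth 0 s m by move=> ?; rewrite s_ge0 ?mem_nth.
have last_le : nth 0 s (size s).-1 <= nth 0 s 1.
  have tr : transitive (>=%R : rel R) by move=> x y z yx zy; exact: le_trans zy yx.
  have := sorted_leq_nth tr (@lexx _ _) 0 sort_s; apply; rewrite ?inE //.
    by rewrite prednK // (ltn_trans _ sz2).
  by rewrite -ltnS prednK // (ltn_trans _ sz2).
rewrite lerBrDl -lerBrDr ge_max !ger0_norm ?le2 ?(le_trans last_le) //.
  by apply: nth_ge0; rewrite prednK // (ltn_trans _ sz2).
exact: nth_ge0.
Qed.

End ReversibleKernels.

(** * Conditional variances *)

Section ConditionalExpectation.
Variables (R : realType) (V : finType) (q : nat) (mu : config V q -> R).
Hypothesis mu_ge0 : forall s, 0 <= mu s.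
Local Notation cfg := {ffun V -> 'I_q}.
Implicit Types (S : {set V}) (s t : cfg) (f g h : cfg -> R).

Definition cls S s : {set cfg} :=
  [set t : cfg | [forall w, (w \notin S) ==> (t w == s w)]].

Lemma clsP S s t : reflect {in ~: S, t =1 s} (t \in cls S s).
Proof.
rewrite inE; apply: (iffP forallP) => [h w|h w].
  by rewrite inE => wS; have := h w; rewrite wS => /eqP.
by apply/implyP => wS; apply/eqP/h; rewrite inE.
Qed.

Lemma cls_refl S s : s \in cls S s. Proof. exact/clsP. Qed.

Lemma cls_sym S s t : (t \in cls S s) = (s \in cls S t).
Proof. by apply/clsP/clsP => h w wS; rewrite h. Qed.

Lemma cls_trans S s t u : t \in cls S s -> u \in cls S t -> u \in cls S s.
Proof. by move=> /clsP st /clsP tu; apply/clsP => w wS; rewrite tu // st. Qed.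

Lemma cls_sub S S' s : S \subset S' -> cls S s \subset cls S' s.
Proof.
move=> sSS; apply/subsetP => t /clsP h; apply/clsP => w wS; apply: h.
by move: wS; rewrite !inE; apply: contra; apply/subsetP.
Qed.

Lemma cls_eq S s t : t \in cls S s -> cls S t = cls S s.
Proof.
move=> st; apply/setP => u; apply/idP/idP => [tu|su]; first exact: cls_trans tu.
by apply: cls_trans su; rewrite cls_sym.
Qed.

Lemma cls0 s : cls set0 s = [set s].
Proof.
apply/setP => t; rewrite in_set1; apply/clsP/eqP => [h|-> //].
by apply/ffunP => w; rewrite h // inE in_set0.
Qed.

Definition dot f g := \sum_s mu s * f s * g s.

(* S is the set of free spins: cexp S f is E[f | spins outside S], and is 0 where
   the conditioning event has probability 0; avar S f is E[Var(f | spins outside S)]. *)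
Definition cexp S f s := (\sum_(t in cls S s) mu t * f t) / Pr mu (cls S s).

Definition avar S f := \sum_s mu s * (f s - cexp S f s) ^+ 2.

Definition cst_on S f := forall s t, t \in cls S s -> f t = f s.

Lemma cst_cexp S f : cst_on S (cexp S f).
Proof. by move=> s t st; rewrite /cexp (cls_eq st). Qed.
Arguments cst_cexp : clear implicits.

Lemma cst_on_sub S S' f : S \subset S' -> cst_on S' f -> cst_on S f.
Proof. by move=> sSS cf s t st; apply: cf; apply: (subsetP (cls_sub s sSS)). Qed.

Lemma Pr_ge0 (A : {set cfg}) : 0 <= Pr mu A.
Proof. exact: sumr_ge0. Qed.

Lemma Pr_sub (A B : {set cfg}) : A \subset B -> Pr mu A <= Pr mu B.
Proof.
move=> /subsetP sAB; rewrite /Pr [leRHS](bigID (mem A)) /=.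
rewrite [X in _ <= X + _](eq_bigl (mem A)); last first.
  by move=> t /=; case tA: (t \in A); rewrite ?andbF // sAB.
by rewrite lerDl sumr_ge0.
Qed.

Lemma mu_le_Pr s (A : {set cfg}) : s \in A -> mu s <= Pr mu A.
Proof. by move=> sA; rewrite /Pr (bigD1 s) //= lerDl sumr_ge0. Qed.

(** For a null class the quotient is 0 by convention, and so is [mu s]. *)
Lemma mu_Pr_cancel S s : mu s / Pr mu (cls S s) * Pr mu (cls S s) = mu s.
Proof.
have [Z0|Z0] := eqVneq (Pr mu (cls S s)) 0; last by rewrite mulfVK.
rewrite Z0 mulr0; apply/esym/eqP; rewrite eq_le mu_ge0 andbT -Z0.
exact/mu_le_Pr/cls_refl.
Qed.

Lemma dotC f g : dot f g = dot g f.
Proof. by apply: eq_bigr => s _; rewrite mulrAC. Qed.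

(** Exchange the double sum over pairs in a common class, where [h] is constant, and collect the
    class weights with [mu_Pr_cancel]. *)
Lemma dot_cexp S f h : cst_on S h -> dot h (cexp S f) = dot h f.
Proof.
move=> ch.
transitivity (\sum_s \sum_t
   (if t \in cls S s then mu s / Pr mu (cls S s) * h s * (mu t * f t) else 0)).
  apply: eq_bigr => s _; rewrite /cexp -big_mkcond /= -mulr_sumr; ring.
rewrite exchange_big /=; apply: eq_bigr => t _.
transitivity (\sum_(s in cls S t) (mu s) * (mu t / Pr mu (cls S t) * h t * f t)).
  rewrite [RHS]big_mkcond /=; apply: eq_bigr => s _; rewrite cls_sym.
  by case: ifP => // st; rewrite (cls_eq st) (ch _ _ st); ring.
rewrite -mulr_suml -/(Pr _ _) -[in RHS](mu_Pr_cancel S t); ring.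
Qed.

Lemma dotBl f g h : dot (fun s => f s - g s) h = dot f h - dot g h.
Proof. by rewrite /dot -sumrB; apply: eq_bigr => s _; ring. Qed.

Lemma dotBr f g h : dot h (fun s => f s - g s) = dot h f - dot h g.
Proof. by rewrite dotC dotBl !(dotC h). Qed.

Lemma dot_ge0 f : 0 <= dot f f.
Proof. by apply: sumr_ge0 => s _; rewrite -mulrA -expr2 mulr_ge0 ?sqr_ge0. Qed.

(** Pythagoras: [cexp mu S] is an orthogonal projection for [dot]. *)
Lemma avarE S f : avar S f = dot f f - dot (cexp S f) (cexp S f).
Proof.
transitivity (dot (fun s => f s - cexp S f s) (fun s => f s - cexp S f s)).
  by apply: eq_bigr => s _; ring.
rewrite dotBl !dotBr (dotC f (cexp S f)) !(dot_cexp _ (cst_cexp S f)); ring.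
Qed.

Lemma avar_ge0 S f : 0 <= avar S f.
Proof. by apply: sumr_ge0 => s _; rewrite mulr_ge0 ?sqr_ge0. Qed.

Lemma sum_cls_cexp S S' f s : S \subset S' ->
  \sum_(t in cls S' s) mu t * cexp S f t = \sum_(t in cls S' s) mu t * f t.
Proof.
move=> sSS; pose h t : R := (t \in cls S' s)%:R.
have ch : cst_on S h.
  move=> t u /(subsetP (cls_sub t sSS)) tu; rewrite /h; congr ((_ : bool)%:R).
  apply/idP/idP => [su|st]; last exact: cls_trans tu.
  by apply: cls_trans su _; rewrite cls_sym.
have E k : dot h k = \sum_(t in cls S' s) mu t * k t.
  rewrite [RHS]big_mkcond; apply: eq_bigr => t _; rewrite /h.
  by case: ifP; rewrite ?mulr1 // mulr0 mul0r.
by rewrite -!E dot_cexp.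
Qed.

Lemma dot_cexp_sub S S' f : S \subset S' ->
  dot (cexp S f) (cexp S' f) = dot (cexp S' f) (cexp S' f).
Proof.
move=> sSS; rewrite dotC (dot_cexp f (cst_on_sub sSS (cst_cexp S' f))).
by rewrite (dot_cexp f (cst_cexp S' f)).
Qed.

Lemma avar0 f : avar set0 f = 0.
Proof.
apply: big1 => s _; rewrite /cexp cls0 /Pr !big_set1.
 have [->|nz] := eqVneq (mu s) 0; first by rewrite mul0r.
by rewrite mulrAC mulfV // mul1r subrr expr0n mulr0.
Qed.

Lemma avarT f : is_distribution mu ->
  avar setT f = (\sum_s mu s * f s ^+ 2) - (\sum_s mu s * f s) ^+ 2.
Proof.
move=> [_ mu1].
have E s : cexp setT f s = \sum_t mu t * f t.
  have clsT : cls setT s =i predT by move=> t; rewrite !inE; apply/forallP => w; rewrite inE.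
  by rewrite /cexp /Pr !(eq_bigl _ _ clsT) mu1 divr1.
rewrite avarE; congr (_ - _); first by apply: eq_bigr => s _; ring.
rewrite /dot; under eq_bigr do rewrite !E -mulrA.
by rewrite -mulr_suml mu1 mul1r.
Qed.

(** A global mean is an average of class means. This passes from an inequality at every feasible
    pinning to one for [mu]. *)
Lemma dot_le0_local S h :
  (forall s, 0 < mu s -> \sum_(t in cls S s) mu t * h t <= 0) ->
  \sum_s mu s * h s <= 0.
Proof.
move=> h_le0; have c1 : cst_on S (fun=> 1) by [].
have := dot_cexp h c1; rewrite /dot; under eq_bigr do rewrite mulr1.
under [in RHS]eq_bigr do rewrite mulr1.
move=> <-; apply: sumr_le0 => s _.
have [->|nz] := eqVneq (mu s) 0; first by rewrite mul0r.
have mu_gt0 : 0 < mu s by rewrite lt_def nz mu_ge0.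
by rewrite mulr_ge0_le0 // mulr_le0_ge0 ?invr_ge0 ?Pr_ge0 // h_le0.
Qed.

(** * Duality between sums of single-site functions and variance decay *)

Section LocalDecay.
Variables (S : {set V}) (f : cfg -> R) (lam : R).
(** Given the spins outside [S], this is a function of the spin at [u] alone, with mean 0. *)
Let g u s := cexp (S :\ u) f s - cexp S f s.
Hypotheses (lam_ge0 : 0 <= lam)
  (gP : \sum_(u in S) \sum_(v in S | v != u) dot (g u) (g v) <=
        lam * \sum_(u in S) dot (g u) (g u)).

(* Expand |D - W / (1 + lam)|^2 >= 0, where D = f - E_S f and W is the sum of the g u. *)
Lemma avar_local_decay :
  (#|S|%:R - 1 - lam) * avar S f <= \sum_(u in S) avar (S :\ u) f.
Proof.
have gg u : dot (g u) (g u) = avar S f - avar (S :\ u) f.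
  have sSu : S :\ u \subset S by rewrite subsetDl.
  rewrite !avarE dotBl !dotBr (dotC (cexp S f) (cexp (S :\ u) f)).
  by rewrite (dot_cexp_sub f sSu); ring.
pose D s := f s - cexp S f s; pose W s := \sum_(u in S) g u s.
(* Up to null classes, [g u] is the projection [cexp mu (S :\ u) D]. *)
have Dg u : dot D (g u) = dot (g u) (g u).
  have sSu : S :\ u \subset S by rewrite subsetDl.
  rewrite gg !avarE dotBl !dotBr.
  rewrite (dotC f) (dot_cexp f (cst_cexp (S :\ u) f)) (dotC f) (dot_cexp f (cst_cexp S f)).
  rewrite (dotC (cexp S f) (cexp (S :\ u) f)) (dot_cexp_sub f sSu).
  by rewrite -!(dot_cexp f (cst_cexp _ f)); ring.
have dot_suml k : dot k W = \sum_(u in S) dot k (g u).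
  by rewrite /dot exchange_big /=; apply: eq_bigr => s _; rewrite mulr_sumr.
pose Q := \sum_(u in S) dot (g u) (g u).
have DW : dot D W = Q by rewrite dot_suml; apply: eq_bigr.
have WW : dot W W <= (1 + lam) * Q.
  rewrite dot_suml; under eq_bigr do rewrite dotC dot_suml.
  rewrite mulrDl mul1r; apply: le_trans (lerD (lexx _) gP).
  rewrite -big_split /=; apply: ler_sum => u uS.
  by rewrite (bigD1 u).
have DD : dot D D = avar S f.
  by apply: eq_bigr => s _; rewrite /D; ring.
(* The multiplier that minimizes [- 2 * c * Q + c ^+ 2 * (1 + lam) * Q]. *)
pose c := (1 + lam)^-1.
have l1 : 0 < 1 + lam by rewrite ltr_wpDr.
have c_gt0 : 0 < c by rewrite invr_gt0.
have c1 : c * (1 + lam) = 1 by rewrite mulVf // lt0r_neq0.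
have := dot_ge0 (fun s => D s - c * W s).
have -> : dot (fun s => D s - c * W s) (fun s => D s - c * W s) =
          dot D D - (2 * c) * dot D W + c ^+ 2 * dot W W.
  rewrite /dot !mulr_sumr -sumrB -big_split; apply: eq_bigr => s _ /=.
  by move: (D s) (W s) => a b; ring.
rewrite DD DW => ge0.
have cWW : c ^+ 2 * dot W W <= c * Q.
  have : c ^+ 2 * dot W W <= c ^+ 2 * ((1 + lam) * Q) by rewrite ler_pM2l // exprn_gt0.
  suff -> : c ^+ 2 * ((1 + lam) * Q) = c * Q by [].
  by rewrite mulrA expr2 -(mulrA c) c1 mulr1.
have cQ : c * Q <= avar S f by nra.
have QA : Q <= (1 + lam) * avar S f.
  by rewrite -(ler_pM2l c_gt0) mulrA c1 mul1r.
move: QA; rewrite /Q; under eq_bigr do rewrite gg.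
by rewrite sumrB sumr_const -mulr_natl; lra.
Qed.

End LocalDecay.

End ConditionalExpectation.

(** * Spectral independence *)

Lemma sum_sig (R : nmodType) (I : finType) (P : pred I) (F : I -> R) :
  \sum_(x : {x | P x}) F (val x) = \sum_(i | P i) F i.
Proof.
rewrite [RHS](reindex_omap val (insub : I -> option {x | P x})) /=; last first.
  by move=> i Pi; rewrite insubT.
by apply: eq_bigl => x; rewrite (valP x) valK eqxx.
Qed.

Section LocalInfluence.
Variables (R : realType) (V : finType) (q : nat) (mu : config V q -> R).
Hypothesis mu_ge0 : forall s, 0 <= mu s.
Local Notation cfg := {ffun V -> 'I_q}.
Implicit Types (S L : {set V}) (s t : cfg).

Definition restr L s : pconfig q L := [ffun w => s (val w)].

Lemma extends_restr L s : extends (restr L s) = cls (~: L) s.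
Proof.
apply/setP => t; rewrite inE; apply/forallP/clsP => [h w|h w].
  by rewrite setCK => wL; have := h (exist _ w wL); rewrite ffunE => /eqP.
by rewrite ffunE; apply/eqP/h; rewrite setCK (valP w).
Qed.

Lemma sum_spin (A : {set cfg}) u (F : 'I_q -> cfg -> R) :
  \sum_(t in A) F (t u) t = \sum_i \sum_(t in spin_is u i :&: A) F i t.
Proof.
rewrite (partition_big (fun t : cfg => t u) predT) //=; apply: eq_bigr => i _.
rewrite (eq_bigl [pred t | t \in spin_is u i :&: A]); last first.
  by move=> t; rewrite !inE andbC.
by apply: eq_bigr => t; rewrite !inE => /andP[/eqP -> _].
Qed.

Variables (C eta : R).
Hypothesis SI : spectrally_independent mu C eta.
Variables (S : {set V}) (s0 : cfg).
Hypotheses (mu_s0 : 0 < mu s0) (S_ge2 : (2 <= #|S|)%N).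

Local Notation K := (cls S s0).
Local Notation tau := (restr (~: S) s0).
Local Notation Zk := (Pr mu K).

Let extK : extends tau = K. Proof. by rewrite extends_restr setCK. Qed.

Let Zk_gt0 : 0 < Zk.
Proof. by apply: (lt_le_trans mu_s0); apply: mu_le_Pr => //; exact: cls_refl. Qed.

Let pi (p : V * 'I_q) := Pr mu (spin_is p.1 p.2 :&: K).
Let joint (p p' : V * 'I_q) := Pr mu (spin_is p'.1 p'.2 :&: (spin_is p.1 p.2 :&: K)).
(** Up to the factor [Zk], the covariance of two spin indicators under the pinned measure, with zero
    diagonal blocks. Its symmetry makes the influence matrix reversible for the weights [pi]. *)
Let k p p' := if p.1 == p'.1 then 0 else joint p p' - pi p * pi p' / Zk.

Let infl_indexE (p : V * 'I_q) :
  (p.1 \notin ~: S) && (0 < condPr mu (spin_is p.1 p.2) (extends tau)) =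
  (p.1 \in S) && (0 < pi p).
Proof. by rewrite inE negbK extK /condPr pmulr_lgt0 ?invr_gt0. Qed.

Let pi_gt0 (x : infl_index mu tau) : 0 < pi (val x).
Proof. by have := valP x; rewrite infl_indexE => /andP[]. Qed.

Let jointC p p' : joint p p' = joint p' p.
Proof. by rewrite /joint setICA. Qed.

Let kE (x y : infl_index mu tau) : pi (val x) * influence x y = k (val x) (val y).
Proof.
rewrite /influence /k; have := pi_gt0 x; case: (val x) (val y) => [u i] [v j] /= px.
case: eqP => _; first by rewrite mulr0.
rewrite /condPr extK -/(pi (u, i)) -/(pi (v, j)) -/(joint (u, i) (v, j)) /pi /=.
have nz := lt0r_neq0 px; rewrite /pi /= in nz.
by have nZ := lt0r_neq0 Zk_gt0; field; rewrite nz nZ.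
Qed.

Let kC p p' : k p p' = k p' p.
Proof. by rewrite /k eq_sym jointC (mulrC (pi p)). Qed.

Let k0 p p' : pi p = 0 -> k p p' = 0.
Proof.
move=> p0; rewrite /k p0 !mul0r subr0; case: eqP => // _; apply/eqP.
rewrite eq_le Pr_ge0 // andbT -p0; apply: Pr_sub => //; exact: subsetIr.
Qed.

Let pi_ge0 p : 0 <= pi p. Proof. exact: Pr_ge0. Qed.

(** The influence matrix is indexed by spins of positive marginal only; summands vanishing at the
    other spins allow sums over all of them. *)
Let sum_index (F : V * 'I_q -> R) : (forall p, pi p = 0 -> F p = 0) ->
  \sum_(x : infl_index mu tau) F (val x) = \sum_(u in S) \sum_i F (u, i).
Proof.
move=> F0; rewrite /infl_index sum_sig (eq_bigl _ _ infl_indexE).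
rewrite pair_big_dep /= big_mkcondr /=; rewrite [RHS](eq_bigl (fun p => p.1 \in S)); last first.
  by move=> p; rewrite andbT.
apply: eq_bigr => -[u i] /= _; case: ifP => // /negbT.
by rewrite -leNgt => pi_le0; rewrite F0 //; apply/eqP; rewrite eq_le pi_le0 pi_ge0.
Qed.

(** For mean-zero [G u], the [pi]-weighted quadratic form of the influence matrix is the sum of the
    cross moments, so the Rayleigh bound applies with the eigenvalue bound given by spectral
    independence. *)
Lemma local_influence (G : V -> 'I_q -> R) :
  (forall u, u \in S -> \sum_(t in K) mu t * G u (t u) = 0) ->
  \sum_(u in S) \sum_(v in S | v != u) \sum_(t in K) mu t * G u (t u) * G v (t v) <=
  Num.min C (eta * (#|S| - 1)%:R) * \sum_(u in S) \sum_(t in K) mu t * G u (t u) ^+ 2.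
Proof.
move=> G0; have meanG u : u \in S -> \sum_i pi (u, i) * G u i = 0.
  move=> uS; rewrite -[RHS](G0 u uS) (sum_spin _ _ (fun i t => mu t * G u i)).
  by apply: eq_bigr => i _; rewrite -mulr_suml.
pose f (x : infl_index mu tau) := G (val x).1 (val x).2.
have card_S : (#|~: S| + #|S| = #|V|)%N by rewrite addnC cardsC.
have le_eig b : eigenvalue (influence_mx mu tau) b -> b <= Num.min C (eta * (#|S| - 1)%:R).
  have := @SI _ tau; rewrite -card_S leq_add2l /feasible extK => /(_ S_ge2 Zk_gt0) h /h.
  by rewrite addKn.
have := @reversible_quad_le _ _ (fun x => pi (val x)) (@influence _ _ _ mu _ tau)
  pi_gt0 _ _ f le_eig.
have -> : \sum_(x : infl_index mu tau) pi (val x) * f x ^+ 2 =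
          \sum_(u in S) \sum_(t in K) mu t * G u (t u) ^+ 2.
  rewrite (sum_index (F := fun p => pi p * G p.1 p.2 ^+ 2)) /=; last first.
    by move=> p ->; rewrite mul0r.
  apply: eq_bigr => u uS; rewrite (sum_spin _ _ (fun i t => mu t * G u i ^+ 2)).
  by apply: eq_bigr => i _; rewrite -mulr_suml.
move=> le_f; apply: le_trans (le_f _); last by move=> x y; rewrite !kE kC.
under [leRHS]eq_bigr do under eq_bigr do rewrite kE.
rewrite (sum_index (F := fun p => \sum_y k p (val y) * G p.1 p.2 * f y)); last first.
  by move=> p p0; apply: big1 => y _; rewrite k0 // !mul0r.
rewrite le_eqVlt; apply/orP; left; apply/eqP; apply: eq_bigr => u uS.
transitivity (\sum_i \sum_(v in S) \sum_j k (u, i) (v, j) * G u i * G v j); last first.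
  apply: eq_bigr => i _.
  rewrite (sum_index (F := fun p => k (u, i) p * G u i * G p.1 p.2)) //.
  by move=> p p0; rewrite kC k0 // !mul0r.
rewrite [RHS]exchange_big /= [RHS](bigD1 u) //= [X in _ = X + _]big1 ?add0r; last first.
  by move=> i _; apply: big1 => j _; rewrite /k eqxx !mul0r.
apply: eq_bigr => v /andP[vS neq_vu].
(* The product of marginals factors, and its [u] factor is the mean of [G u], which is 0. *)
transitivity (\sum_i \sum_j (joint (u, i) (v, j) * G u i * G v j -
   (pi (u, i) * G u i) * (pi (v, j) * G v j / Zk))); last first.
  apply: eq_bigr => i _; apply: eq_bigr => j _.
  by rewrite /k /= eq_sym (negPf neq_vu); ring.
under [RHS]eq_bigr do rewrite sumrB -mulr_sumr.
rewrite sumrB -mulr_suml meanG // mul0r subr0.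
rewrite (sum_spin _ _ (fun i t => mu t * G u i * G v (t v))); apply: eq_bigr => i _.
rewrite (sum_spin _ _ (fun j t => mu t * G u i * G v j)); apply: eq_bigr => j _.
by rewrite -!mulr_suml.
Qed.

End LocalInfluence.

Section SpectralDecay.
Variables (R : realType) (V : finType) (q : nat) (mu : config V q -> R).
Hypothesis mu_ge0 : forall s, 0 <= mu s.
Local Notation cfg := {ffun V -> 'I_q}.
Variables (C eta : R).
Hypotheses (SI : spectrally_independent mu C eta) (C_ge0 : 0 <= C) (eta_ge0 : 0 <= eta).

(** In a class of [S], the value of [g u] can be read at [upd u i], which is [s0] with spin [i] at
    [u]. Then [local_influence] bounds the cross terms class by class, and [dot_le0_local]
    integrates over the classes. *)
Lemma spectral_decay (S : {set V}) (f : cfg -> R) : (2 <= #|S|)%N ->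
  (#|S|%:R - 1 - Num.min C (eta * (#|S| - 1)%:R)) * avar mu S f <=
  \sum_(u in S) avar mu (S :\ u) f.
Proof.
move=> S_ge2; apply: avar_local_decay => //.
  by rewrite le_min C_ge0 mulr_ge0.
set lam := Num.min _ _; set g := fun u s => cexp mu (S :\ u) f s - cexp mu S f s.
pose h s := (\sum_(u in S) \sum_(v in S | v != u) g u s * g v s) - lam * \sum_(u in S) g u s ^+ 2.
rewrite -subr_le0; suff <- : \sum_s mu s * h s =
   \sum_(u in S) \sum_(v in S | v != u) dot mu (g u) (g v) -
   lam * \sum_(u in S) dot mu (g u) (g u).
  apply: (dot_le0_local mu_ge0 (S := S)) => s0 mu_s0.
  pose upd u i : cfg := [ffun w => if w == u then i else s0 w].
  have gE u t : t \in cls S s0 -> g u t = g u (upd u (t u)).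
    move=> /clsP tK.
    have t_upd : t \in cls (S :\ u) (upd u (t u)).
      apply/clsP => w; rewrite !inE negb_and negbK ffunE.
      by case: eqP => [->|_] //= wS; rewrite tK // inE.
    rewrite /g (cst_cexp _ _ t_upd); congr (_ - _).
    by apply: cst_cexp; apply: subsetP t_upd; rewrite cls_sub // subsetDl.
  have := local_influence mu_ge0 SI mu_s0 S_ge2 (G := fun u i => g u (upd u i)).
  rewrite -/lam -subr_le0 => le0; apply: le_trans (le0 _); last first.
    move=> u uS; transitivity (\sum_(t in cls S s0) mu t * g u t).
      by apply: eq_bigr => t tK; rewrite -gE.
    under eq_bigr do rewrite mulrBr.
    by rewrite sumrB !sum_cls_cexp ?subrr // subsetDl.
  rewrite le_eqVlt; apply/orP; left; apply/eqP.
  rewrite /h; under eq_bigr do rewrite mulrBr mulr_sumr.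
  rewrite sumrB exchange_big /=; congr (_ - _).
    apply: eq_bigr => u uS; under eq_bigr do rewrite mulr_sumr.
    rewrite exchange_big /=; apply: eq_bigr => v _; apply: eq_bigr => t tK.
    by rewrite -!gE // mulrA.
  under eq_bigr do rewrite mulrCA mulr_sumr.
  rewrite -mulr_sumr exchange_big /=; congr (_ * _); apply: eq_bigr => u _.
  by apply: eq_bigr => t tK; rewrite -gE.
rewrite /h; under eq_bigr do rewrite mulrBr mulr_sumr.
rewrite sumrB exchange_big /=; congr (_ - _).
  apply: eq_bigr => u uS; under eq_bigr do rewrite mulr_sumr.
  rewrite exchange_big /=; apply: eq_bigr => v _; apply: eq_bigr => t _.
  by rewrite mulrA.
under eq_bigr do rewrite mulrCA mulr_sumr.
rewrite -mulr_sumr exchange_big /=; congr (_ * _); apply: eq_bigr => u _.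
by apply: eq_bigr => t _; rewrite expr2 mulrA.
Qed.

End SpectralDecay.

(** * The Markov property *)

Section Tensorization.
Variables (R : realType) (V : finType) (q : nat) (mu : config V q -> R) (e : rel V).
Hypotheses (mu_ge0 : forall s, 0 <= mu s) (mrf : markov_random_field mu e).
Local Notation cfg := {ffun V -> 'I_q}.
Implicit Types (S A B : {set V}) (s t : cfg) (f : cfg -> R).

Lemma clsI S S' s : cls S s :&: cls S' s = cls (S :&: S') s.
Proof.
apply/setP => t; rewrite in_setI; apply/andP/clsP.
  by case=> /clsP h /clsP h' w; rewrite setCI => /setUP[]; [exact: h | exact: h'].
by move=> h; split; apply/clsP => w wS; apply: h; rewrite setCI inE wS ?orbT.
Qed.

Section TwoBlocks.
Variables (A B : {set V}).
Hypotheses (AB0 : [disjoint A & B]) (noE : forall u v, u \in A -> v \in B -> ~~ e u v).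

(** The Markov property at the spins of [s], denominators cleared: given the spins outside
    [A :|: B], fixing those in [A] leaves [cls B s], and conversely. Null classes are harmless, as
    both sides vanish. *)
Lemma mrf_factor s :
  mu s * Pr mu (cls (A :|: B) s) = Pr mu (cls A s) * Pr mu (cls B s).
Proof.
have AB : A :&: B = set0 by apply/eqP; rewrite setI_eq0.
have [Z0|nZ] := eqVneq (Pr mu (cls (A :|: B) s)) 0.
  suff -> : Pr mu (cls A s) = 0 by rewrite Z0 mulr0 mul0r.
  apply/eqP; rewrite eq_le Pr_ge0 // andbT -Z0.
  by apply: Pr_sub => //; apply: cls_sub; exact: subsetUl.
have feas : feasible mu (restr (~: (A :|: B)) s).
  by rewrite /feasible extends_restr setCK lt_def nZ Pr_ge0.
have := mrf AB0 noE (restr A s) (restr B s) feas.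
rewrite /condPr !extends_restr setCK !clsI.
have -> : ~: A :&: ~: B :&: (A :|: B) = set0 by rewrite -setCU setIC setICr.
have -> : ~: A :&: (A :|: B) = B.
  rewrite setIUr [~: A :&: A]setIC setICr set0U; apply/setIidPr.
  by rewrite -disjoints_subset disjoint_sym.
have -> : ~: B :&: (A :|: B) = A.
  by rewrite setIUr [~: B :&: B]setIC setICr setU0; apply/setIidPr; rewrite -disjoints_subset.
have -> : Pr mu (cls set0 s) = mu s by rewrite cls0 /Pr big_set1.
by move=> h; rewrite -[mu s](divfK nZ) h; field.
Qed.

(** By [mrf_factor] the ratio [mu t / Pr mu (cls B t)] is the same for all [t] in [cls A s] whose
    class [cls B t] is not null, and the classes [cls B t] partition [cls (A :|: B) s]. *)
Lemma cexp_blocks f s : 0 < mu s ->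
  cexp mu A (cexp mu B f) s = cexp mu (A :|: B) f s.
Proof.
move=> mus; have sA := cls_refl A s.
have nz S : Pr mu (cls S s) != 0.
  by rewrite lt0r_neq0 // (lt_le_trans mus) // mu_le_Pr // cls_refl.
have sAU : A \subset A :|: B by rewrite subsetUl.
rewrite {1}/cexp; apply: (mulIf (nz A)); rewrite mulfVK //.
transitivity (\sum_(t in cls A s) Pr mu (cls A s) / Pr mu (cls (A :|: B) s) *
    \sum_(r in cls B t) mu r * f r).
  apply: eq_bigr => t tA; rewrite /cexp mulrA.
  have [Z0|nZ] := eqVneq (Pr mu (cls B t)) 0.
    suff -> : \sum_(r in cls B t) mu r * f r = 0 by rewrite mulr0 mul0r mulr0.
    apply: big1 => r rB; suff -> : mu r = 0 by rewrite mul0r.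
    by apply/eqP; rewrite eq_le mu_ge0 andbT -Z0 mu_le_Pr.
  have := mrf_factor t; rewrite (cls_eq tA) (cls_eq (subsetP (cls_sub s sAU) _ tA)) => fac.
  rewrite mulrAC; congr (_ * _).
  by apply/eqP; rewrite eqr_div // fac.
rewrite -mulr_sumr {1}/cexp.
suff -> : \sum_(t in cls A s) \sum_(r in cls B t) mu r * f r =
          \sum_(r in cls (A :|: B) s) mu r * f r.
  by rewrite mulrC -mulrA; congr (_ * _); rewrite mulrC.
(* The representative in [cls A s] of the part containing [r]: it keeps the spins of [r] on [A]. *)
pose p (r : cfg) : cfg := [ffun w => if w \in A then r w else s w].
rewrite [RHS](partition_big p (mem (cls A s))) /=; last first.
  by move=> r _; apply/clsP => w; rewrite inE ffunE => /negPf ->.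
apply: eq_bigr => t tA; apply: eq_bigl => r; apply/idP/andP.
  move=> /clsP rB; move/clsP: tA => tA; split.
    apply/clsP => w; rewrite !inE negb_or => /andP[wA wB].
    by rewrite rB ?tA // inE.
  apply/eqP/ffunP => w; rewrite ffunE; case: ifP => wA; last by rewrite tA // inE wA.
  by rewrite rB // inE; apply: contraL wA => wB; rewrite (disjointFl AB0 wB).
case=> /clsP rS /eqP <-; apply/clsP => w; rewrite inE ffunE => wB.
by case: ifP => // wA; rewrite rS // !inE wA.
Qed.

(** Projecting [D = f - E_B f] by [E_A] does not increase its norm. The norm of [D] squared is A(B),
    and that of its projection is A(A :|: B) - A(A), because [E_A E_B] is the expectation over
    [A :|: B]. *)
Lemma avar_blocks f : avar mu (A :|: B) f <= avar mu A f + avar mu B f.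
Proof.
pose D s := f s - cexp mu B f s.
have DA s : cexp mu A D s = cexp mu A f s - cexp mu A (cexp mu B f) s.
  by rewrite /cexp -mulrBl -sumrB; congr (_ / _); apply: eq_bigr => t _; rewrite mulrBr.
have := avar_ge0 mu_ge0 A D; rewrite avarE // subr_ge0.
have -> : dot mu D D = avar mu B f by apply: eq_bigr => s _; rewrite /D; ring.
have -> : dot mu (cexp mu A D) (cexp mu A D) =
  dot mu (fun s => cexp mu A f s - cexp mu (A :|: B) f s)
         (fun s => cexp mu A f s - cexp mu (A :|: B) f s).
  apply: eq_bigr => s _; have [->|nz] := eqVneq (mu s) 0; first by rewrite !mul0r.
  by rewrite DA cexp_blocks // lt_def nz mu_ge0.
rewrite dotBl !dotBr (dotC _ (cexp mu (A :|: B) f) (cexp mu A f)).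
rewrite dot_cexp_sub ?subsetUl // !(avarE mu_ge0 A) (avarE mu_ge0 (A :|: B)); lra.
Qed.

End TwoBlocks.

(* Connectivity as absence of a nontrivial separation, the form in which the Markov
   property applies. *)
Definition conn (U : {set V}) :=
  (U != set0) && [forall A : {set V}, (A \proper U) && (A != set0) ==>
    [exists u in A, exists v in U :\: A, e u v]].

(** Induction on the size of [S], splitting along a separation. A nonempty [U] cannot lie in both
    parts, so nothing is counted twice. Summing over all connected subsets, not just components,
    makes the later exchange with a sum over [S] direct. *)
Lemma avar_conn S f :
  avar mu S f <= \sum_(U : {set V} | conn U && (U \subset S)) avar mu U f.
Proof.
have [m] := ubnP #|S|; elim: m S => // m IH S lt_m.
have sum_ge0 (P : pred {set V}) : 0 <= \sum_(U : {set V} | P U) avar mu U f.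
  by apply: sumr_ge0 => U _; exact: avar_ge0.
have [->|nzS] := eqVneq S set0; first by rewrite avar0.
have [cS|ncS] := boolP (conn S).
  by rewrite (bigD1 S) /= ?cS ?subxx // lerDl sum_ge0.
have := ncS; rewrite {1}/conn nzS /= negb_forall => /existsP[A]; rewrite negb_imply.
case/andP=> /andP[pA nzA] /existsPn noA.
pose B := S :\: A; have sAS := proper_sub pA.
have AB : [disjoint A & B] by rewrite -setI_eq0 /B setIDA setIC -setIDA setDv setI0.
have noE u v : u \in A -> v \in B -> ~~ e u v.
  move=> uA vB; have := noA u; rewrite uA /= => /existsPn /(_ v).
  by rewrite -/B vB.
have SU : A :|: B = S.
  by apply/setP => x; rewrite !inE; case xA: (x \in A) => //=; rewrite (subsetP sAS).
have sBS : B \subset S by rewrite subsetDl.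
have ltA : (#|A| < m)%N by rewrite (leq_trans (proper_card pA)).
have ltB : (#|B| < m)%N.
  rewrite ltnS in lt_m; apply: (leq_trans _ lt_m); rewrite cardsD (setIidPr sAS) ltn_subrL.
  by rewrite !card_gt0 nzA nzS.
rewrite -{1}SU; apply: le_trans (avar_blocks AB noE f) _.
apply: le_trans (lerD (IH _ ltA) (IH _ ltB)) _.
rewrite [leRHS](bigID (fun U : {set V} => U \subset A)) /=; apply: lerD.
  rewrite le_eqVlt; apply/orP; left; apply/eqP; apply: eq_bigl => U.
  case sUA: (U \subset A); rewrite ?andbF // !andbT.
  by rewrite (subset_trans sUA sAS) andbT.
rewrite [leRHS](bigID (fun U : {set V} => U \subset B)) /=.
rewrite -[leLHS]addr0 lerD //.
rewrite le_eqVlt; apply/orP; left; apply/eqP; apply: eq_bigl => U.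
case sUB: (U \subset B); rewrite ?andbF // !andbT.
rewrite (subset_trans sUB sBS) andbT; case cU: (conn U) => //=.
apply/esym/negP => sUA; case/andP: cU => /set0Pn[x xU] _.
by have := disjointFr AB (subsetP sUA _ xU); rewrite (subsetP sUB _ xU).
Qed.

End Tensorization.

(** * Connected sets through a vertex *)

Lemma bernoulli (R : realDomainType) (y : R) n : -1 <= y -> 1 + n%:R * y <= (1 + y) ^+ n.
Proof.
move=> y1; elim: n => [|n IH]; first by rewrite mul0r addr0 expr0.
have h : 0 <= 1 + y by lra.
have := ler_wpM2l h IH; rewrite -exprS; apply: le_trans.
have n0 : 0 <= n%:R * y ^+ 2 by rewrite mulr_ge0 ?ler0n ?sqr_ge0.
by rewrite -natr1; nra.
Qed.

Section ConnectedSets.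
Variables (R : realFieldType) (V : finType) (e : rel V) (D : nat) (x : R).
Hypotheses (D_gt0 : (0 < D)%N) (degD : forall u, (#|[set v | e u v]| <= D)%N).
Hypotheses (x_ge0 : 0 <= x) (x_le : 4 * D%:R * x <= 1).
Implicit Types (I X U : {set V}).

(* With I the vertices already included and X those excluded, revealing a vertex of
   the boundary decreases the boundary by one if it is excluded and adds at most D
   vertices to it if it is included; b solves 1 + x b^D <= b. *)
Definition boundary I X :=
  [set w | [&& w \notin I, w \notin X & [exists u in I, e u w]]].

(** Bernoulli gives [(1 - y) ^+ D >= 1/2], hence [b ^+ D <= 2]. Then [x * b ^+ D <= 2 * x <= y],
    while [b >= 1 + y]. *)
Let y : R := (2 * D%:R)^-1.
Let b := (1 - y)^-1.

Let D0 : 0 < D%:R :> R. Proof. by rewrite ltr0n. Qed.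
Let Dy : 2 * D%:R * y = 1. Proof. by rewrite mulfV // mulf_neq0 ?pnatr_eq0 ?gtn_eqF. Qed.
Let y0 : 0 < y. Proof. by rewrite invr_gt0 mulr_gt0. Qed.
Let y12 : y <= 2^-1.
Proof.
have : 1 <= D%:R :> R by rewrite ler1n.
by move: Dy y0; nra.
Qed.
Let b_inv : b * (1 - y) = 1.
Proof. by rewrite mulVf //; apply/eqP; move: y12; lra. Qed.
Let b1 : 1 + y <= b.
Proof.
have : 0 < b by rewrite invr_gt0; move: y12; lra.
by move: b_inv y0 y12; nra.
Qed.
Let bD : b ^+ D <= 2.
Proof.
have h : 2^-1 <= (1 - y) ^+ D.
  by apply: le_trans (bernoulli (y := - y) D _); move: y12 Dy; lra.
have e1 : b ^+ D * (1 - y) ^+ D = 1 by rewrite -exprMn b_inv expr1n.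
have : 0 < b ^+ D by rewrite exprn_gt0 //; move: b1 y0; lra.
by move: h e1; nra.
Qed.
Let b_step : 1 + x * b ^+ D <= b.
Proof.
have h1 : x * b ^+ D <= x * 2 by rewrite ler_wpM2l.
by move: b1 Dy D0 x_le h1; nra.
Qed.

(** Induction on the number of vertices neither included nor excluded. *)
Lemma conn_weight_from I X : I != set0 ->
  \sum_(U : {set V} | [&& conn e U, I \subset U & [disjoint U & X]]) x ^+ #|U| <=
  x ^+ #|I| * b ^+ #|boundary I X|.
Proof.
have b_ge1 : 1 <= b by move: b1 y0; lra.
have b_ge0 : 0 <= b by lra.
have [m] := ubnP #|~: (I :|: X)|; elim: m I X => // m IH I X lt_m nzI.
have [bd0|[w wbd]] := set_0Vmem (boundary I X).
  (* With an empty boundary only [U = I] remains: a larger connected [U] would have an edge from [I]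
     to a vertex of [U] outside [I], which is not in [X] either. *)
  rewrite bd0 cards0 expr0 mulr1.
  apply: (@le_trans _ _ (\sum_(U : {set V} | U == I) x ^+ #|U|)); last by rewrite big_pred1_eq.
  rewrite big_mkcond [leRHS]big_mkcond /=; apply: ler_sum => U _.
  case: ifP => [/and3P[cU sIU UX]|_]; last by case: ifP; rewrite ?exprn_ge0.
  case: eqP => [//|/eqP neq]; exfalso.
  case/andP: cU => _ /forallP/(_ I); rewrite properEneq eq_sym neq sIU nzI /=.
  case/existsP=> u /andP[uI /existsP[v /andP[vUI euv]]].
  suff : v \in boundary I X by rewrite bd0 inE.
  move: vUI; rewrite !inE => /andP[-> vU]; rewrite (disjointFr UX vU) /=.
  by apply/existsP; exists u; rewrite uI.
have := wbd; rewrite inE => /and3P[wI wX _].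
have lt_setC I' X' : w \notin I :|: X -> w |: (I :|: X) \subset I' :|: X' ->
    (#|~: (I' :|: X')| < m)%N.
  move=> wn sub; rewrite ltnS in lt_m; apply: leq_trans lt_m; apply: proper_card.
  rewrite properE setCS (subset_trans (subsetUr _ _) sub) /=.
  apply/subsetPn; exists w; first by rewrite inE.
  by rewrite inE negbK; apply: (subsetP sub); rewrite setU11.
have wIX : w \notin I :|: X by rewrite inE negb_or wI.
have [IHin IHout] :
    \sum_(U : {set V} | [&& conn e U, w |: I \subset U & [disjoint U & X]]) x ^+ #|U| <=
      x ^+ #|w |: I| * b ^+ #|boundary (w |: I) X| /\
    \sum_(U : {set V} | [&& conn e U, I \subset U & [disjoint U & w |: X]]) x ^+ #|U| <=
      x ^+ #|I| * b ^+ #|boundary I (w |: X)|.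
  split; apply: IH => //; try apply: lt_setC => //.
  - by rewrite setUA.
  - by apply/set0Pn; exists w; rewrite setU11.
  - by rewrite setUCA.
rewrite (bigID (fun U : {set V} => w \in U)) /=.
rewrite (eq_bigl (fun U : {set V} =>
  [&& conn e U, w |: I \subset U & [disjoint U & X]])); last first.
  by move=> U; rewrite subUset sub1set; case: (w \in U); rewrite ?andbT ?andbF.
rewrite [X in _ + X](eq_bigl (fun U : {set V} =>
  [&& conn e U, I \subset U & [disjoint U & w |: X]])); last first.
  by move=> U; rewrite !disjoints_subset setCU setIC -setDE subsetD1 -!andbA.
apply: le_trans (lerD IHin IHout) _.
set B := #|boundary I X|; have B_gt0 : (0 < B)%N by apply/card_gt0P; exists w.
have Bout : (#|boundary I (w |: X)| <= B.-1)%N.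
  rewrite -ltnS prednK //; apply: proper_card; apply/properP; split; last first.
    by exists w => //; rewrite !inE eqxx andbF.
  by apply/subsetP => u; rewrite !inE negb_or => /and3P[-> /andP[_ ->] ->].
have Bin : (#|boundary (w |: I) X| <= B.-1 + D)%N.
  apply: (@leq_trans #|(boundary I X :\ w) :|: [set v | e w v]|); last first.
    apply: leq_trans (leq_card_setU _ _) _; rewrite leq_add //.
    by rewrite /B (cardsD1 w (boundary I X)) wbd.
  apply/subset_leq_card/subsetP => u.
  rewrite !inE negb_or => /and3P[/andP[-> ->] -> /existsP[v]].
  rewrite !inE => /andP[/orP[/eqP->|vI] evu]; first by rewrite evu orbT.
  by rewrite orbC /=; apply/orP; right; apply/existsP; exists v; rewrite vI.
have Xin : x ^+ #|w |: I| * b ^+ #|boundary (w |: I) X| <= x ^+ #|I| * b ^+ B.-1 * (x * b ^+ D).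
  rewrite cardsU1 wI add1n exprSr -!mulrA ler_wpM2l ?exprn_ge0 //.
  rewrite [leRHS]mulrCA ler_wpM2l // -exprD; exact: ler_weXn2l.
have Xout : x ^+ #|I| * b ^+ #|boundary I (w |: X)| <= x ^+ #|I| * b ^+ B.-1.
  by rewrite ler_wpM2l ?exprn_ge0 //; exact: ler_weXn2l.
apply: le_trans (lerD Xin Xout) _.
(* The two branches add up to a factor [1 + x * b ^+ D], which [b_step] bounds by [b]. *)
rewrite -[X in _ + X]mulr1 -mulrDr addrC -{2}(prednK B_gt0) exprSr mulrA.
by rewrite ler_wpM2l // ?mulr_ge0 ?exprn_ge0 // addrC.
Qed.

(** Exploration from [v] with nothing excluded: the initial boundary consists of neighbours of [v],
    and [b ^+ D <= 2]. *)
Lemma conn_weight v : \sum_(U : {set V} | conn e U && (v \in U)) x ^+ #|U| <= 2 * x.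
Proof.
have nz : [set v] != set0 by apply/set0Pn; exists v; rewrite set11.
have := conn_weight_from set0 nz; rewrite cards1 expr1.
rewrite (eq_bigl (fun U : {set V} => conn e U && (v \in U))); last first.
  by move=> U; rewrite sub1set disjoints_subset setC0 subsetT andbT.
move=> /le_trans; apply; rewrite mulrC ler_wpM2r //; apply: le_trans bD.
apply: ler_weXn2l; first by move: b1 y0; lra.
apply: leq_trans (degD v); apply/subset_leq_card/subsetP => u.
by rewrite !inE => /andP[_ /existsP[z /andP[]]]; rewrite inE => /eqP->.
Qed.

End ConnectedSets.

(** * Averaging over sets of fixed size *)

Section SetFunctions.
Variables (R : realFieldType) (V : finType) (a : {set V} -> R).
Hypothesis a_ge0 : forall S, 0 <= a S.
Implicit Types (S U : {set V}).

Definition layer m := \sum_(S : {set V} | #|S| == m) a S.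

(** Each set of size [m] arises by removing any one of the [#|V| - m] vertices outside it. *)
Lemma sum_layer_remove m :
  \sum_(S : {set V} | #|S| == m.+1) \sum_(u in S) a (S :\ u) = (#|V| - m)%:R * layer m.
Proof.
rewrite (exchange_big_dep predT) //= /layer mulr_sumr.
transitivity (\sum_u \sum_(T : {set V} | (#|T| == m) && (u \notin T)) a T).
  apply: eq_bigr => u _.
  rewrite (reindex_onto (fun T : {set V} => u |: T) (fun S => S :\ u)) /=; last first.
    by move=> S /andP[_ uS]; rewrite setD1K.
  apply: eq_big => [T|T /andP[_ /eqP->] //].
  rewrite setU11 andbT cardsU1; case uT: (u \in T) => /=; last first.
    by rewrite add1n eqSS andbT setU1K ?uT // eqxx andbT.
  rewrite andbF; apply/negP => /andP[_ /eqP/setP/(_ u)].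
  by rewrite setD11 uT.
rewrite (exchange_big_dep (fun T : {set V} => #|T| == m)) /=; last by move=> u T _ /andP[].
apply: eq_bigr => T /eqP cT; rewrite (eq_bigl (mem (~: T))); last first.
  by move=> u; rewrite cT eqxx /= inE.
by rewrite sumr_const cardsCs setCK cT mulr_natl.
Qed.

Section Descent.
Variables (k l : nat).
Hypotheses (l_gt0 : (0 < l)%N) (l_le : (l <= #|V|)%N).
Hypothesis decay : forall S j, #|S| = j.+1 -> (l <= j)%N ->
  j%:R ^+ 2 * a S <= (j + k)%:R * \sum_(u in S) a (S :\ u).

(** The mean of [a] over sets of size j grows by at most [(j + k) * (j + 1) / j ^+ 2] per step, and
    Bernoulli bounds this by [((j + 1) / j) ^+ k.+1]; dividing by [j ^+ k.+1] makes the quantity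
    monotone. *)
Lemma layer_step j : (l <= j < #|V|)%N ->
  layer j.+1 / ('C(#|V|, j.+1)%:R * j.+1%:R ^+ k.+1) <=
  layer j / ('C(#|V|, j)%:R * j%:R ^+ k.+1).
Proof.
move=> /andP[lj jV]; have j_gt0 := leq_trans l_gt0 lj.
have le1 : j%:R ^+ 2 * layer j.+1 <= (j + k)%:R * ((#|V| - j)%:R * layer j).
  rewrite -sum_layer_remove /layer !mulr_sumr; apply: ler_sum => S /eqP cS.
  exact: decay.
have bern : (j + k)%:R * j%:R ^+ k <= j%:R * j.+1%:R ^+ k :> R.
  have j0 : 0 < j%:R :> R by rewrite ltr0n.
  have : 1 + k%:R * j%:R^-1 <= (1 + j%:R^-1) ^+ k :> R.
    by apply: bernoulli; apply: (@le_trans _ _ 0); rewrite ?lerN10 ?invr_ge0 ?ler0n.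
  rewrite -(@ler_pM2l _ (j%:R ^+ k.+1)) ?exprn_gt0 // exprS.
  have -> : j%:R * j%:R ^+ k * (1 + k%:R * j%:R^-1) = (j + k)%:R * j%:R ^+ k :> R.
    by rewrite natrD; field; rewrite lt0r_neq0.
  by rewrite -!mulrA -exprMn mulrDr mulr1 mulfV ?lt0r_neq0 // natr1.
have binE : 'C(#|V|, j.+1)%:R * j.+1%:R = 'C(#|V|, j)%:R * (#|V| - j)%:R :> R.
  by rewrite -!natrM mulnC mul_bin_left mulnC.
have C0 i : (i <= #|V|)%N -> 0 < 'C(#|V|, i)%:R :> R by rewrite ltr0n bin_gt0.
have Cj := C0 j (ltnW jV); have Cj1 := C0 _ jV.
have j0 : 0 < j%:R :> R by rewrite ltr0n.
have j1 : 0 < j.+1%:R :> R by rewrite ltr0n.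
have V0 : 0 < (#|V| - j)%:R :> R by rewrite ltr0n subn_gt0.
have lay0 : 0 <= layer j by apply: sumr_ge0.
rewrite ler_pdivrMr ?mulr_gt0 ?exprn_gt0 // mulrAC ler_pdivlMr ?mulr_gt0 ?exprn_gt0 //.
rewrite [j.+1%:R ^+ _]exprS (mulrA 'C(_, _)%:R) binE.
rewrite -(@ler_pM2l _ (j%:R ^+ 2)) ?exprn_gt0 // mulrA.
apply: (@le_trans _ _ ((j + k)%:R * ((#|V| - j)%:R * layer j) * ('C(#|V|, j)%:R * j%:R ^+ k.+1))).
  by rewrite ler_wpM2r // mulr_ge0 ?exprn_ge0 // ltW.
have -> : (j + k)%:R * ((#|V| - j)%:R * layer j) * ('C(#|V|, j)%:R * j%:R ^+ k.+1) =
  (layer j * (#|V| - j)%:R * 'C(#|V|, j)%:R * j%:R) * ((j + k)%:R * j%:R ^+ k).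
  by rewrite exprS; ring.
have -> : j%:R ^+ 2 * (layer j * ('C(#|V|, j)%:R * (#|V| - j)%:R * j.+1%:R ^+ k)) =
  (layer j * (#|V| - j)%:R * 'C(#|V|, j)%:R * j%:R) * (j%:R * j.+1%:R ^+ k) by ring.
by rewrite ler_wpM2l // !mulr_ge0 // ltW.
Qed.

Lemma layer_descent :
  a setT <= (#|V|%:R / l%:R) ^+ k.+1 * (layer l / 'C(#|V|, l)%:R).
Proof.
have V_gt0 : (0 < #|V|)%N := leq_trans l_gt0 l_le.
have mono m : (l <= m <= #|V|)%N ->
  layer m / ('C(#|V|, m)%:R * m%:R ^+ k.+1) <= layer l / ('C(#|V|, l)%:R * l%:R ^+ k.+1).
  elim: m => [|m IH] /andP[]; first by rewrite leqNgt l_gt0.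
  rewrite leq_eqVlt => /orP[/eqP->|lm] mV //.
  rewrite ltnS in lm; apply: le_trans (IH _); last by rewrite lm ltnW.
  by apply: layer_step; rewrite lm.
have := mono #|V|; rewrite l_le leqnn => /(_ isT).
have -> : layer #|V| = a setT.
  rewrite /layer (eq_bigl (pred1 setT)) ?big_pred1_eq // => S /=.
  by rewrite eqEcard subsetT /= cardsT eqn_leq max_card.
rewrite binn mul1r ler_pdivrMr ?exprn_gt0 ?ltr0n // => /le_trans; apply.
rewrite le_eqVlt; apply/orP; left; apply/eqP; rewrite expr_div_n; field.
by rewrite expf_neq0 ?pnatr_eq0 -?lt0n ?bin_gt0 ?l_le.
Qed.

End Descent.

Section Blocks.
Variables (k : nat) (r b : R).
Hypotheses (r_ge1 : 1 <= r) (b_ge1 : 1 <= b).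
Hypothesis decay_small : forall S j, #|S| = j.+2 ->
  j.+1%:R * a S <= r * \sum_(u in S) a (S :\ u).
Hypothesis decay_large : forall S j, #|S| = j.+2 -> (k <= j)%N ->
  j.+1%:R * a S <= b * \sum_(u in S) a (S :\ u).

(** Vertices are removed one at a time, at cost [r] for sets of size at most [k + 1] and [b] above;
    small sizes also spend a spare factor [b]. Each [v] survives in all but one of the sets
    [S :\ u], which cancels the factor on the left of the hypotheses. *)
Lemma block_bound S j : #|S| = j.+1 ->
  a S <= r ^+ minn j k * b ^+ j * \sum_(v in S) a [set v].
Proof.
have [r_ge0 b_ge0] : 0 <= r /\ 0 <= b by split; apply: le_trans ler01 _.
elim: j S => [|j IH] S cS.
  move/eqP/cards1P: cS => [v ->].
  by rewrite min0n !expr0 !mul1r big_set1.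
have sum_ge0 : 0 <= \sum_(v in S) a [set v] by apply: sumr_ge0.
have j0 : 0 < j.+1%:R :> R by rewrite ltr0n.
have IHS : \sum_(u in S) a (S :\ u) <=
    j.+1%:R * (r ^+ minn j k * b ^+ j * \sum_(v in S) a [set v]).
  apply: (@le_trans _ _ (\sum_(u in S) r ^+ minn j k * b ^+ j * \sum_(v in S :\ u) a [set v])).
    apply: ler_sum => u uS; apply: IH.
    by move: cS; rewrite (cardsD1 u S) uS => -[].
  rewrite -mulr_sumr mulrCA ler_wpM2l ?mulr_ge0 ?exprn_ge0 //.
  have -> : \sum_(u in S) \sum_(v in S :\ u) a [set v] =
            \sum_(u in S) (\sum_(v in S) a [set v] - a [set u]).
    by apply: eq_bigr => u uS; rewrite (big_setD1 u uS) /= addrAC subrr add0r.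
  by rewrite sumrB sumr_const cS mulrSr addrK mulr_natl.
rewrite -(ler_pM2l j0); case: (leqP k j) => [kj|jk].
  apply: le_trans (decay_large cS kj) _; apply: le_trans (ler_wpM2l b_ge0 IHS) _.
  by rewrite (minn_idPr kj) (minn_idPr (leqW kj)) exprS le_eqVlt; apply/orP; left; apply/eqP; ring.
apply: le_trans (decay_small cS) _; apply: le_trans (ler_wpM2l r_ge0 IHS) _.
rewrite (minn_idPl (ltnW jk)) (minn_idPl jk) mulrCA ler_wpM2l ?ler0n // mulrA ler_wpM2r //.
rewrite mulrA -exprS ler_wpM2l ?exprn_ge0 // exprS ler_peMl ?exprn_ge0 //.
Qed.

End Blocks.

End SetFunctions.

(** Each step of the induction uses [(l - m) / (n - m) <= l / n]. *)
Lemma bin_ratio n l m : (m <= l <= n)%N -> ('C(n - m, l - m) * n ^ m <= 'C(n, l) * l ^ m)%N.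
Proof.
move=> /andP[]; elim: m => [|m IH] ml ln; first by rewrite !subn0.
have nm : (0 < n - m)%N by rewrite subn_gt0 (leq_trans ml).
rewrite -(leq_pmul2l nm) mulnA.
have -> : ((n - m) * 'C(n - m.+1, l - m.+1) = (l - m) * 'C(n - m, l - m))%N.
  have lm : (l - m = (l - m.+1).+1)%N by rewrite subnSK.
  by rewrite lm -mul_bin_diag (subnS n).
rewrite expnS mulnACA.
apply: (@leq_trans (((n - m) * l) * ('C(n - m, l - m) * n ^ m))%N).
  rewrite leq_mul2r; apply/orP; right.
  by rewrite !mulnBl [(l * n)%N]mulnC leq_sub2l // leq_mul2l ln orbT.
rewrite -[leqLHS]mulnA leq_mul2l expnS; apply/orP; right.
by rewrite [leqRHS]mulnCA leq_mul2l IH ?orbT // ltnW.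
Qed.

(** A uniform random set of size [l] contains [U] with probability at most [(l / #|V|) ^+ #|U|];
    supersets are counted through the injective map removing [U]. *)
Lemma card_supersets (V : finType) (U : {set V}) l : (l <= #|V|)%N ->
  (#|[set S : {set V} | (#|S| == l) && (U \subset S)]| * #|V| ^ #|U| <=
   'C(#|V|, l) * l ^ #|U|)%N.
Proof.
move=> lV; have [Ul|lU] := leqP #|U| l; last first.
  rewrite (_ : [set S | _] = set0) ?cards0 //; apply/setP => S; rewrite !inE.
  by apply/negP => /andP[/eqP cS /subset_leq_card]; rewrite cS leqNgt lU.
apply: leq_trans (bin_ratio (m := #|U|) _); last by rewrite Ul.
rewrite leq_mul2r; apply/orP; right.
have <- : #|~: U| = (#|V| - #|U|)%N by rewrite cardsCs setCK.
rewrite -cards_draws.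
rewrite -(@card_in_imset _ _ (fun S : {set V} => S :\: U)); last first.
  move=> S T; rewrite !inE => /andP[_ /setIidPr US] /andP[_ /setIidPr UT] eqD.
  by rewrite -(setID S U) -(setID T U) eqD US UT.
apply/subset_leq_card/subsetP => T /imsetP[S]; rewrite inE => /andP[/eqP cS US] ->.
by rewrite !inE setDE subsetIr -setDE cardsD (setIidPr US) cS eqxx.
Qed.

(** * The Glauber dynamics *)

Section Glauber.
Variables (R : realType) (V : finType) (q : nat) (mu : config V q -> R).
Hypothesis mu_distr : is_distribution mu.
Local Notation cfg := {ffun V -> 'I_q}.
Local Notation n := (#|V|%:R : R).

Let mu_ge0 : forall s, 0 <= mu s. Proof. by case: mu_distr. Qed.

Lemma same_offE v (s : cfg) : same_off v s = cls [set v] s.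
Proof. by apply/setP => t; rewrite !inE; apply: eq_forallb => w; rewrite inE. Qed.

Lemma glauberE (x y : glauber_state mu) :
  glauber x y = \sum_v n^-1 *
    (if val y \in cls [set v] (val x) then mu (val y) / Pr mu (cls [set v] (val x)) else 0).
Proof.
apply: eq_bigr => v _; rewrite same_offE; congr (_ * _).
case: ifP => // xy; rewrite /condPr; congr (_ / _).
rewrite (_ : _ :&: _ = [set val y]) ?/Pr ?big_set1 //.
apply/setP => t; rewrite in_setI in_set1 [t \in spin_is _ _]inE.
apply/andP/eqP => [[/eqP tv /clsP tx]|->]; last first.
  by rewrite eqxx.
apply/ffunP => w; have [->//|wv] := eqVneq w v.
by rewrite tx ?inE // (clsP _ _ _ xy) ?inE.
Qed.

Lemma glauber_rev (x y : glauber_state mu) :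
  mu (val x) * glauber x y = mu (val y) * glauber y x.
Proof.
rewrite !glauberE !mulr_sumr; apply: eq_bigr => v _.
rewrite [_ \in cls _ (val y)]cls_sym; case: ifP => xy; last by rewrite !mulr0.
by rewrite (cls_eq xy); ring.
Qed.

Lemma sum_state (H : cfg -> R) : (forall s, mu s = 0 -> H s = 0) ->
  \sum_(x : glauber_state mu) H (val x) = \sum_s H s.
Proof.
move=> H0; rewrite /glauber_state sum_sig big_mkcond; apply: eq_bigr => s _.
case: ifP => // /negbT; rewrite -leNgt => mus; rewrite H0 //.
by apply/eqP; rewrite eq_le mus mu_ge0.
Qed.

(** The transition operator is the average over [v] of the projections [cexp mu [set v]]. *)
Lemma glauber_quad (F : cfg -> R) :
  \sum_(x : glauber_state mu) \sum_(y : glauber_state mu)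
    mu (val x) * glauber x y * F (val x) * F (val y) =
  n^-1 * \sum_v dot mu F (cexp mu [set v] F).
Proof.
pose H s t := mu s * (\sum_v n^-1 *
    (if t \in cls [set v] s then mu t / Pr mu (cls [set v] s) else 0)) * F s * F t.
transitivity (\sum_s \sum_t H s t).
  rewrite -(sum_state (H := fun s => \sum_t H s t)); last first.
    by move=> s s0; apply: big1 => t _; rewrite /H s0 !mul0r.
  apply: eq_bigr => x _; rewrite -(sum_state (H := H (val x))); last first.
    move=> t t0; rewrite /H big1 ?mulr0 ?mul0r // => v _.
    by rewrite t0 mul0r if_same mulr0.
  by apply: eq_bigr => y _; rewrite /H glauberE.
transitivity (\sum_s \sum_v n^-1 * (mu s * F s * cexp mu [set v] F s)).
  apply: eq_bigr => s _; transitivity (\sum_t \sum_v n^-1 * (mu s * F s *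
     (if t \in cls [set v] s then mu t * F t / Pr mu (cls [set v] s) else 0))).
    apply: eq_bigr => t _; rewrite /H mulr_sumr !mulr_suml.
    by apply: eq_bigr => v _; case: ifP => _; ring.
  rewrite exchange_big /=; apply: eq_bigr => v _.
  by rewrite -!mulr_sumr -big_mkcond /cexp mulr_suml.
rewrite exchange_big mulr_sumr /=; apply: eq_bigr => v _.
by rewrite /dot mulr_sumr.
Qed.

(** An average of orthogonal projections has a nonnegative form, and its Dirichlet form is the
    average of the single-site variances, so [reversible_gap] applies. *)
Lemma glauber_gap (g : R) : 0 <= g <= 1 ->
  (forall F : cfg -> R, g * avar mu setT F <= n^-1 * \sum_v avar mu [set v] F) ->
  exists2 gap, is_spectral_gap (glauber_mx mu) gap & g <= gap.
Proof.
move=> g01 poin.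
(* The value outside the support is arbitrary, since [mu] vanishes there. *)
pose ext (f : glauber_state mu -> R) (s : cfg) : R :=
  if insub s is Some x then f x else 0.
have extE f x : ext f (val x) = f x by rewrite /ext valK.
have nV : 0 <= n^-1 by rewrite invr_ge0.
have quadE f : \sum_x \sum_y mu (val x) * glauber x y * f x * f y =
    n^-1 * \sum_v dot mu (ext f) (cexp mu [set v] (ext f)).
  rewrite -glauber_quad; apply: eq_bigr => x _; apply: eq_bigr => y _.
  by rewrite !extE.
have dotE v F : dot mu F (cexp mu [set v] F) = dot mu F F - avar mu [set v] F.
  rewrite avarE // dotC -(dot_cexp mu_ge0 F (@cst_cexp _ _ _ mu [set v] F)); ring.
apply: (@reversible_gap _ _ (fun x : glauber_state mu => mu (val x)) (@glauber _ _ _ mu)) => //.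
- by move=> x; exact: (valP x).
- exact: glauber_rev.
- move=> f; rewrite quadE mulr_ge0 // sumr_ge0 // => v _.
  by rewrite dotC -(dot_cexp mu_ge0 _ (@cst_cexp _ _ _ mu [set v] _)) dot_ge0.
move=> f; rewrite quadE; set F := ext f.
have -> : \sum_x mu (val x) * f x ^+ 2 = \sum_s mu s * F s ^+ 2.
  rewrite -(sum_state (H := fun s => mu s * F s ^+ 2)) => [|s ->]; last by rewrite mul0r.
  by apply: eq_bigr => x _; rewrite /F extE.
have -> : \sum_x mu (val x) * f x = \sum_s mu s * F s.
  rewrite -(sum_state (H := fun s => mu s * F s)) => [|s ->]; last by rewrite mul0r.
  by apply: eq_bigr => x _; rewrite /F extE.
have := poin F; rewrite avarT //.
have FF : dot mu F F = \sum_s mu s * F s ^+ 2 by apply: eq_bigr => s _; ring.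
have F0 : 0 <= dot mu F F by exact: dot_ge0.
under [X in _ -> n^-1 * X <= _]eq_bigr do rewrite dotE.
rewrite sumrB sumr_const -mulr_natl mulrBr mulrA -FF.
(* Only an inequality, to include an empty [V], where the inverse of 0 is 0. *)
have n1 : n^-1 * n <= 1.
  have [->|nz] := eqVneq n 0; first by rewrite mulr0 ler01.
  by rewrite mulVf.
have : n^-1 * n * dot mu F F <= dot mu F F by rewrite ler_piMl.
by lra.
Qed.

End Glauber.

(** * Poincare inequality *)

Section Poincare.
Variables (R : realType) (V : finType) (q : nat) (mu : config V q -> R) (C eta : R).
Hypotheses (mu_ge0 : forall s, 0 <= mu s).
Hypotheses (SI : spectrally_independent mu C eta) (C_ge0 : 0 <= C) (eta01 : 0 <= eta < 1).
Local Notation n := #|V|.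
Implicit Types (S U : {set V}) (F : {ffun V -> 'I_q} -> R).

Let r : R := (1 - eta)^-1.

Let eta_ge0 : 0 <= eta. Proof. by case/andP: eta01. Qed.

Let r_inv : r * (1 - eta) = 1.
Proof. by rewrite mulVf // subr_eq0 gt_eqF //; case/andP: eta01. Qed.

Let r_gt0 : 0 < r. Proof. by rewrite invr_gt0 subr_gt0; case/andP: eta01. Qed.

(** The [eta] branch of the minimum, informative at every size; the [C] branch below is so only once
    [#|S| - 1] exceeds [C]. *)
Lemma decay_small S j F : #|S| = j.+2 ->
  j.+1%:R * avar mu S F <= r * \sum_(u in S) avar mu (S :\ u) F.
Proof.
move=> cS; have S2 : (2 <= #|S|)%N by rewrite cS.
have := spectral_decay mu_ge0 SI C_ge0 eta_ge0 F S2.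
rewrite cS subn1 /= -[j.+2%:R]natr1 addrK => dec.
have -> : j.+1%:R * avar mu S F = r * ((1 - eta) * (j.+1%:R * avar mu S F)).
  by rewrite mulrA r_inv mul1r.
rewrite ler_pM2l //; apply: le_trans dec.
rewrite mulrA ler_wpM2r ?avar_ge0 // mulrBl mul1r lerD2l lerN2.
by rewrite ge_min lexx orbT.
Qed.

Lemma decay_C S j F : #|S| = j.+2 ->
  (j.+1%:R - C) * avar mu S F <= \sum_(u in S) avar mu (S :\ u) F.
Proof.
move=> cS; have S2 : (2 <= #|S|)%N by rewrite cS.
have := spectral_decay mu_ge0 SI C_ge0 eta_ge0 F S2.
rewrite cS -[j.+2%:R]natr1 addrK; apply: le_trans.
by rewrite ler_wpM2r ?avar_ge0 // lerD2l lerN2 ge_min lexx.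
Qed.

(** With [C = 0] no step of the descent loses anything, so it can run from all of [V] down to
    singletons. *)
Lemma poincare_C0 F : C = 0 -> (0 < n)%N ->
  avar mu setT F <= \sum_v avar mu [set v] F.
Proof.
move=> C0 n_gt0; have dec S j : #|S| = j.+2 ->
    j.+1%:R * avar mu S F <= 1 * \sum_(u in S) avar mu (S :\ u) F.
  by move=> cS; rewrite mul1r; have := decay_C F cS; rewrite C0 subr0.
have cT : #|[set: V]| = n.-1.+1 by rewrite cardsT prednK.
have := block_bound (a := fun S => avar mu S F) (avar_ge0 mu_ge0 ^~ F) (k := 0)
  (lexx 1) (lexx 1) dec (fun S j cS _ => dec S j cS) cT.
rewrite !expr1n !mul1r => /le_trans; apply.
by rewrite le_eqVlt; apply/orP; left; apply/eqP; apply: eq_bigl => v; rewrite inE.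
Qed.

Section Shattering.
Variables (e : rel V) (D k l : nat).
Hypotheses (mrf : markov_random_field mu e) (degD : forall u, (#|[set v | e u v]| <= D)%N).
Hypotheses (D_gt0 : (0 < D)%N) (C_le : 2 * C <= k%:R).
Hypotheses (l_gt0 : (0 < l)%N) (k_le_l : (k <= l)%N) (l_le : (8 * D * l <= n)%N).

Let r_ge1 : 1 <= r. Proof. by rewrite invf_ge1; case/andP: eta01; lra. Qed.

Lemma block_poincare U F : U != set0 ->
  avar mu U F <= r ^+ k * 2 ^+ #|U| * \sum_(v in U) avar mu [set v] F.
Proof.
rewrite -card_gt0 => U0; have cU : #|U| = #|U|.-1.+1 by rewrite prednK.
have two : 1 <= 2 :> R by rewrite ler1n.
(* Since [2 * C <= k <= j.+1], the factor [j.+1 - C] is at least half of [j.+1]. *)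
have dec2 S j : #|S| = j.+2 -> (k <= j)%N ->
    j.+1%:R * avar mu S F <= 2 * \sum_(u in S) avar mu (S :\ u) F.
  move=> cS kj; have := decay_C F cS; have := avar_ge0 mu_ge0 S F.
  have : k%:R <= j.+1%:R :> R by rewrite ler_nat leqW.
  by move: C_le; nra.
have := block_bound (a := fun S => avar mu S F) (avar_ge0 mu_ge0 ^~ F)
  r_ge1 two (fun S j => @decay_small S j F) dec2 cU.
move=> /le_trans; apply; apply: ler_wpM2r; first by apply: sumr_ge0 => v _; exact: avar_ge0.
apply: ler_pM; rewrite ?exprn_ge0 //; first exact: ltW.
  by rewrite ler_weXn2l // geq_minr.
by rewrite ler_weXn2l // leq_pred.
Qed.

Let n_gt0 : (0 < n)%N.
Proof. by apply: leq_trans l_le; rewrite !muln_gt0 D_gt0. Qed.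

Let ln : (l <= n)%N.
Proof. by apply: leq_trans l_le; rewrite leq_pmull // muln_gt0. Qed.

Let theta : R := l%:R / n%:R.

(** After exchanging sums, a connected [U] is counted at most ['C(n, l) * theta ^+ #|U|] times; with
    the [2 ^+ #|U|] of [block_poincare] this is the weight of [conn_weight] at [x = 2 * theta]. *)
Lemma layer_shattered F :
  layer (fun S => avar mu S F) l <=
  'C(n, l)%:R * r ^+ k * (4 * theta) * \sum_v avar mu [set v] F.
Proof.
have th_ge0 : 0 <= theta by rewrite divr_ge0.
have n0 : 0 < n%:R :> R by rewrite ltr0n.
pose N U := #|[set S : {set V} | (#|S| == l) && (U \subset S)]|.
have N_le U : (N U)%:R <= 'C(n, l)%:R * theta ^+ #|U|.
  rewrite expr_div_n mulrA ler_pdivlMr ?exprn_gt0 // -!natrX -!natrM ler_nat.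
  exact: card_supersets.
apply: (@le_trans _ _ (\sum_(U | conn e U) 'C(n, l)%:R * theta ^+ #|U| *
    (r ^+ k * 2 ^+ #|U| * \sum_(v in U) avar mu [set v] F))).
  apply: (@le_trans _ _ (\sum_(U | conn e U) (N U)%:R * avar mu U F)); last first.
    apply: ler_sum => U cU; apply: ler_pM; rewrite ?ler0n ?avar_ge0 //.
    by apply: block_poincare; case/andP: cU.
  apply: (@le_trans _ _ (\sum_(S : {set V} | #|S| == l)
      \sum_(U : {set V} | conn e U && (U \subset S)) avar mu U F)).
    by apply: ler_sum => S _; apply: avar_conn.
  rewrite (exchange_big_dep (conn e)) /=; last by move=> S U _ /andP[].
  apply: ler_sum => U cU; rewrite cU /= /N.
  rewrite (eq_bigl (mem [set S : {set V} | (#|S| == l) && (U \subset S)])); last first.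
    by move=> S; rewrite /= inE.
  by rewrite sumr_const mulr_natl.
have -> : \sum_(U | conn e U) 'C(n, l)%:R * theta ^+ #|U| *
    (r ^+ k * 2 ^+ #|U| * \sum_(v in U) avar mu [set v] F) =
  'C(n, l)%:R * r ^+ k * \sum_v (\sum_(U : {set V} | conn e U && (v \in U))
     (2 * theta) ^+ #|U|) * avar mu [set v] F.
  transitivity ('C(n, l)%:R * r ^+ k * \sum_(U | conn e U) \sum_(v in U)
      (2 * theta) ^+ #|U| * avar mu [set v] F).
    rewrite mulr_sumr; apply: eq_bigr => U _; rewrite -mulr_sumr [(2 * theta) ^+ _]exprMn.
    by move: (\sum_(v in U) _) (theta ^+ _) (2 ^+ _) (r ^+ k) => x y z t; ring.
  congr (_ * _); rewrite (exchange_big_dep predT) //=; apply: eq_bigr => v _.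
  by rewrite mulr_suml.
rewrite -[leRHS]mulrA ler_wpM2l //; first by rewrite mulr_ge0 ?exprn_ge0 // ltW.
rewrite mulr_sumr; apply: ler_sum => v _; rewrite ler_wpM2r ?avar_ge0 //.
have -> : 4 * theta = 2 * (2 * theta) by ring.
apply: (conn_weight D_gt0) => //; first by rewrite mulr_ge0.
(* The condition [4 * D * x <= 1] of [conn_weight] is exactly [l_le]. *)
have -> : 4 * D%:R * (2 * theta) = (8 * D * l)%:R / n%:R by rewrite /theta !natrM; ring.
by rewrite ler_pdivrMr // mul1r ler_nat.
Qed.

(** One of the [k + 1] factors [n / l] lost in the descent cancels [theta]; each of the others is at
    most [16 * D]. *)
Lemma poincare_shattered F : (n <= 16 * D * l)%N ->
  avar mu setT F <= 4 * (16 * D%:R) ^+ k * r ^+ k * \sum_v avar mu [set v] F.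
Proof.
move=> n_le; have n0 : 0 < n%:R :> R by rewrite ltr0n.
have l0 : 0 < l%:R :> R by rewrite ltr0n.
(* From [C <= k / 2] and [k <= j] follows [(j + k) * (j - C) >= j ^+ 2]. *)
have dec S j : #|S| = j.+1 -> (l <= j)%N ->
    j%:R ^+ 2 * avar mu S F <= (j + k)%:R * \sum_(u in S) avar mu (S :\ u) F.
  case: j => [|j] cS lj; first by move: l_gt0; rewrite ltnNge lj.
  have := decay_C F cS; have := avar_ge0 mu_ge0 S F.
  have : k%:R <= j.+1%:R :> R by rewrite ler_nat (leq_trans k_le_l).
  have : 0 <= k%:R :> R by [].
  rewrite natrD; move: C_le; move: (j.+1%:R : R) (k%:R : R) => x y h1 h2 h3 h4 h5.
  have h6 : (x + y) * ((x - C) * avar mu S F) <= (x + y) * \sum_(u in S) avar mu (S :\ u) F.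
    by rewrite ler_wpM2l //; lra.
  apply: le_trans h6; rewrite mulrA ler_wpM2r //; nra.
have sum_ge0 : 0 <= \sum_v avar mu [set v] F by apply: sumr_ge0 => v _; exact: avar_ge0.
apply: le_trans (layer_descent (avar_ge0 mu_ge0 ^~ F) l_gt0 ln dec) _.
have C0 : 0 < 'C(n, l)%:R :> R by rewrite ltr0n bin_gt0.
have : layer (fun S => avar mu S F) l / 'C(n, l)%:R <=
    r ^+ k * (4 * theta) * \sum_v avar mu [set v] F.
  rewrite ler_pdivrMr //; apply: le_trans (layer_shattered F) _.
  by rewrite [leRHS]mulrC [leRHS]mulrA [X in _ <= X * _]mulrA.
move=> h; apply: le_trans (ler_wpM2l _ h) _; first by rewrite exprn_ge0 // divr_ge0.
have -> X : (n%:R / l%:R) ^+ k.+1 * (r ^+ k * (4 * theta) * X) =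
    4 * (n%:R / l%:R) ^+ k * r ^+ k * X.
  rewrite exprSr /theta; move: (_ ^+ k) (r ^+ k) => y z.
  by field; rewrite !lt0r_neq0.
rewrite ler_wpM2r //.
rewrite (ler_pM2r (exprn_gt0 k r_gt0)) ler_pM2l ?ltr0n // lerXn2r ?nnegrE ?divr_ge0 ?mulr_ge0 //.
by rewrite ler_pdivrMr // -!natrM ler_nat.
Qed.

End Shattering.

End Poincare.

(** * Choice of the set size and comparison of constants *)

Theorem theorem1p1 (R : realType) :
  exists2 c : R, 0 < c &
  forall (V : finType) (e : rel V) (Delta q : nat) (C eta : R)
         (mu : config V q -> R),
    simple_graph e -> max_degree e = Delta ->
    (2 <= q)%N -> 0 <= C -> 0 <= eta < 1 ->
    is_distribution mu -> markov_random_field mu e ->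
    spectrally_independent mu C eta ->
    50 * Num.ceil (2 * C) * Delta%:Z <= #|V|%:Z ->
    exists2 gap : R, is_spectral_gap (glauber_mx mu) gap &
      c * ((1 - eta) `^ (1 + 2 * C)
           / (25 * Delta%:Z * Num.ceil (2 * C))%:~R ^ (5 * Num.ceil (2 * C)))
        * (1 / #|V|%:R) <= gap.
Proof.
(* The constant cancels the factor 4 of [poincare_shattered]. *)
exists 4^-1 => [|V e D q C eta mu _ maxD _ C_ge0 eta01 distr mrf SI]; first by rewrite invr_gt0.
have mu_ge0 : forall s, 0 <= mu s by case: distr.
have := ceil_ge (2 * C); have := ceilB1_lt (2 * C).
have : 0 <= Num.ceil (2 * C) by rewrite ceil_ge0; apply: lt_le_trans (_ : 0 <= _); lra.
case: (Num.ceil (2 * C)) => // k _; rewrite intrB /= => k_lt k_ge n_ge.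
have {}k_lt : k%:R - 1 < 2 * C by [].
have {}k_ge : 2 * C <= k%:R by [].
have {}n_ge : (50 * k * D <= #|V|)%N by [].
have -> : (25 * D%:Z * k%:Z)%:~R ^ (5 * k%:Z) = (25 * D * k)%:R ^+ (5 * k) :> R by [].
set p := (1 - eta) `^ _; set N := (25 * D * k)%N.
have [eta_ge0 eta_lt1] := andP eta01.
have p_ge0 : 0 <= p by exact: powR_ge0.
(* The base is at most 1, and [k < 1 + 2 * C] because [k] is the ceiling of [2 * C]. *)
have p_le : p <= (1 - eta) ^+ k.
  rewrite -powR_mulrn ?subr_ge0 ?(ltW eta_lt1) // /p ger_powR //.
    by rewrite subr_gt0 eta_lt1 gerBl.
  by lra.
have p_le1 : p <= 1 by apply: le_trans p_le _; rewrite exprn_ile1 //; lra.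
have inv_le1 m : 0 <= (m%:R : R)^-1 <= 1.
  rewrite invr_ge0 ler0n; case: m => [|m]; first by rewrite invr0 ler01.
  by rewrite invf_le1 ?ltr0n // ler1n.
have NE : (N%:R : R) ^+ (5 * k) = (N ^ (5 * k))%:R by rewrite natrX.
set g := _ * _ * _; have g01 : 0 <= g <= 1.
  have /andP[i0 i1] := inv_le1 (N ^ (5 * k))%N; have /andP[j0 j1] := inv_le1 #|V|.
  rewrite /g NE div1r !mulr_ge0 ?invr_ge0 //= mulr_ile1 ?mulr_ge0 ?invr_ge0 //.
  rewrite mulr_ile1 ?mulr_ge0 ?invr_ge0 // ?mulr_ile1 //.
  by rewrite invf_le1 // ler1n.
apply: glauber_gap => // F.
have sum_ge0 : 0 <= \sum_v avar mu [set v] F by apply: sumr_ge0 => v _; exact: avar_ge0.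
have [V0|V_gt0] := posnP #|V|.
  have -> : g = 0 by rewrite /g V0 invr0 !mulr0.
  by rewrite V0 invr0 !mul0r.
have V0 : 0 < #|V|%:R^-1 :> R by rewrite invr_gt0 ltr0n.
(* Here the denominator of the bound is a positive power of 0, so its inverse is 0 and [g = 0]. *)
have [/andP[k_gt0 /eqP D0]|] := boolP ((0 < k)%N && (D == 0%N)).
  have -> : g = 0.
    by rewrite /g NE /N D0 muln0 mul0n exp0n ?muln_gt0 // invr0 !(mulr0, mul0r).
  by rewrite mul0r mulr_ge0 // ltW.
rewrite negb_and -leqNgt leqn0 -lt0n => kD.
suff [P P_gt0 [poin gP]] : exists2 P : R, 0 < P &
    avar mu setT F <= P * \sum_v avar mu [set v] F /\ 4^-1 * (p / N%:R ^+ (5 * k)) * P <= 1.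
  rewrite /g div1r mulrAC mulrC ler_wpM2l ?(ltW V0) //.
  apply: le_trans (ler_wpM2l _ poin) _; first by rewrite !mulr_ge0 ?invr_ge0 ?exprn_ge0.
  by rewrite [leLHS]mulrA; apply: ler_piMl.
have [k0|k_gt0] := posnP k.
  have C0 : C = 0 by apply/eqP; rewrite eq_le C_ge0 andbT; move: k_ge; rewrite k0; lra.
  exists 1 => //; rewrite mul1r; split; first exact: poincare_C0 SI C_ge0 eta01 _ C0 V_gt0.
  by rewrite k0 muln0 expr0 divr1 mulr1; lra.
have D_gt0 : (0 < D)%N by case/orP: kD => // /eqP k0; rewrite k0 in k_gt0.
(* The largest [l] with [8 * D * l <= n]; the hypothesis [50 * k * D <= n] makes it at least [k],
   and rounding down costs at most a factor 2. *)
pose l := (#|V| %/ (8 * D))%N.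
have l_le : (8 * D * l <= #|V|)%N by rewrite mulnC leq_trunc_div.
have D8 : (0 < 8 * D)%N by rewrite muln_gt0.
have k_le_l : (k <= l)%N.
  rewrite leq_divRL //; apply: leq_trans n_ge.
  by rewrite mulnCA mulnA leq_mul2r leq_mul2r orbT orbT.
have l_gt0 := leq_trans k_gt0 k_le_l.
have n_le : (#|V| <= 16 * D * l)%N.
  have : (#|V| < 8 * D * l.+1)%N by rewrite mulnC ltn_ceil.
  move/ltnW/leq_trans; apply.
  have -> : (16 * D * l = 8 * D * (2 * l))%N by rewrite [RHS]mulnCA !mulnA.
  by rewrite leq_pmul2l // mul2n -addnn -(addn1 l) leq_add2l.
have degD u : (#|[set v | e u v]| <= D)%N by rewrite -maxD /max_degree leq_bigmax.
exists (4 * (16 * D%:R) ^+ k * (1 - eta)^-1 ^+ k).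
  by rewrite !mulr_gt0 ?exprn_gt0 ?mulr_gt0 ?invr_gt0 ?ltr0n ?subr_gt0.
split.
  exact: (poincare_shattered mu_ge0 SI C_ge0 eta01 mrf degD D_gt0 k_ge l_gt0 k_le_l l_le).
(* Since [k >= 1], [N = 25 * D * k] is at least [16 * D], and raising the power from [k] to [5 * k]
   only increases it. *)
have N_ge : (16 * D%:R) ^+ k <= N%:R ^+ (5 * k) :> R.
  rewrite -natrM -!natrX ler_nat; apply: (@leq_trans (N ^ k)).
    rewrite leq_exp2r //; apply: leq_trans (leq_pmulr _ k_gt0).
    by rewrite leq_mul2r orbT.
  by rewrite leq_pexp2l // ?muln_gt0 ?D_gt0 // leq_pmull.
have NK_gt0 : 0 < N%:R ^+ (5 * k) :> R by rewrite exprn_gt0 // ltr0n !muln_gt0 D_gt0.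
have e_gt0 : 0 < 1 - eta by rewrite subr_gt0.
have -> : 4^-1 * (p / N%:R ^+ (5 * k)) * (4 * (16 * D%:R) ^+ k * (1 - eta)^-1 ^+ k) =
    (p / (1 - eta) ^+ k) * ((16 * D%:R) ^+ k / N%:R ^+ (5 * k)).
  rewrite exprVn; move: NK_gt0 (exprn_gt0 k e_gt0).
  move: (N%:R ^+ _) ((1 - eta) ^+ k) ((16 * D%:R) ^+ k) => x y z x0 y0.
  by field; rewrite !lt0r_neq0.
rewrite mulr_ile1 ?divr_ge0 ?exprn_ge0 ?mulr_ge0 ?(ltW e_gt0) //.
  by rewrite ler_pdivrMr ?mul1r ?exprn_gt0.
by rewrite ler_pdivrMr ?mul1r.
Qed.
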